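(* For any $\delta>0$ and $\sigma>0$ there exist positive constants $c_1,c_2,c_3$ (depending only on $\delta,\sigma$) with the following property, for all $d,n,V,\Delta$ as in the context. Suppose that ${\tt Matching}$ is a 1-hop $\sigma$-stretched skew-symmetric matching cover with ${\tt size}({\tt Matching})\ge\delta$, that $K\Delta\le c_1$, and that $K=2^r$ for some nonnegative integer $r$. Then ${\tt size}\big({\tt SamplePaths}^K_{[c_2K]}\big)\ge e^{-c_3K^2}$, where ${\tt SamplePaths}^K$ is the chaining of ${\tt Matching}$.
   Context: Fix integers $d,n\ge1$, a set $V\subset\mathbb R^d$ of $n$ distinct points, and a parameter $\Delta>0$. A path is a sequence $p=(p_0,\ldots,p_\ell)$ of points of $V$ with $\ell\ge1$. A path is violating if it contains a contiguous subsequence $(p'_0,\ldots,p'_m)$, $m\ge1$, with $\sum_{j=1}^m\|p'_j-p'_{j-1}\|^2\le\|p'_m-p'_0\|^2-\Delta$; otherwise it is nonviolating. A generalized matching is a set $M$ of paths such that every $x\in V$ is the first point of at most one path of $M$ and the last point of at most one path of $M$. For generalized matchings $M_1,M_2$, $M_1\circ M_2$ is the set of all concatenations $(p_0,\ldots,p_\ell=q_0,q_1,\ldots,q_m)$ of a path $(p_0,\ldots,p_\ell)\in M_1$ and a path $(q_0,\ldots,q_m)\in M_2$ with $p_\ell=q_0$. For a generalized matching $M$, $u\in\mathbb R^d$ and $s\in\mathbb R$, ${\tt Truncate}_s(M;u)$ is the set of violating paths of $M$ together with the nonviolating paths $(x,\ldots,y)\in M$ with $\langle y-x,u\rangle\ge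 s$. Gaussians: $u\sim\mathcal N$ means $u\in\mathbb R^d$ has i.i.d. $N(0,1)$ coordinates; for $\omega\in[0,1)$, $u'\sim_\omega u$ means $u'=\omega u+\sqrt{1-\omega^2}\,g$ with $g\sim\mathcal N$ independent. A matching cover is a map $\mathcal M$ assigning to each $u\in\mathbb R^d$ a probability distribution $\mathcal M(u)$ over generalized matchings. ${\tt size}(\mathcal M)=\frac1n\mathbb E_{u\sim\mathcal N,M\sim\mathcal M(u)}[|M|]$. $\mathcal M$ is skew-symmetric if for every $u$, sampling $M\sim\mathcal M(-u)$ and reversing all its paths gives the distribution $\mathcal M(u)$. $\mathcal M$ is $s$-stretched if for every $u$ every nonviolating path $(x,\ldots,y)$ of every $M$ in the support of $\mathcal M(u)$ satisfies $\langle y-x,u\rangle\ge s$. $\mathcal M$ is $k$-hop if for every $u$ every path of every $M$ in the support of $\mathcal M(u)$ has the form $(p_0,\ldots,p_k)$ with $\|p_i-p_{i-1}\|^2\le\Delta$ for all $i\in[k]$. $\mathcal M_{[s]}$ is the matching cover which, given $u$, samples $M\sim\mathcal M(u)$ and outputs ${\tt Truncate}_s(M;u)$. Chaining: for a matching cover ${\tt Matching}$ and integer $K\ge1$, ${\tt SamplePaths}^K$ is the matching cover which, given $u$, sets $\omega=1-1/K$, $u_1=u$, samples $u_{i+1}\sim_\omega u_i$ for $i=1,\ldots,K-1$, samples $M_i\sim{\tt Matching}(u_i)$ independently, and outputs $M_1\circ\cdots\circ M_K$. *)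

(* Defs.v *)
From HB Require Import structures.
From mathcomp Require Import all_boot all_order all_algebra.
From mathcomp Require Import finmap.
From mathcomp Require Import all_classical all_reals all_analysis measurable_realfun normal_distribution.

Set Implicit Arguments.
Unset Strict Implicit.
Unset Printing Implicit Defensive.

Import Order.TTheory GRing.Theory Num.Theory.
Import numFieldNormedType.Exports.

Local Open Scope classical_set_scope.
Local Open Scope ring_scope.

Section kernel_tools.
Context d d' d3 (X : measurableType d) (Y : measurableType d')
  (Z : measurableType d3) (R : realType).

Section kcomp_prob.
Variables (l : R.-pker X ~> Y) (k : R.-pker (X * Y) ~> Z).

(* Sample y from [l x], then sample from [k (x, y)]: the library composition,
   repackaged so that it is again a probability kernel. *)
Definition pkcomp : X -> {measure set Z -> \bar R} := (l \; k)%E.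

Let pkcomp_measurable U : measurable U -> measurable_fun [set: X] (fun x => pkcomp x U).
Proof. exact: (@measurable_fun_mkcomp_sfinite _ _ _ X Y Z R l k). Qed.

HB.instance Definition _ := isKernel.Build _ _ X Z R pkcomp pkcomp_measurable.

Let pkcomp_prob x : pkcomp x [set: Z] = 1%E.
Proof.
rewrite /pkcomp/= /kcomp (eq_integral (cst 1%E)).
  by rewrite integral_cst// mul1e prob_kernel.
by move=> y _; rewrite prob_kernel.
Qed.

HB.instance Definition _ := Kernel_isProbability.Build _ _ X Z R
  pkcomp pkcomp_prob.
End kcomp_prob.

Section kprecomp.
Variables (f : X -> Y) (mf : measurable_fun [set: X] f) (k : R.-pker Y ~> Z).

Definition kprecomp of measurable_fun [set: X] f :
  X -> {measure set Z -> \bar R} := fun x => k (f x).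

Let kprecomp_measurable U : measurable U ->
  measurable_fun [set: X] (fun x => kprecomp mf x U).
Proof.
by move=> mU; apply: (measurableT_comp (measurable_kernel k U mU)).
Qed.

HB.instance Definition _ := isKernel.Build _ _ X Z R (kprecomp mf)
  kprecomp_measurable.

Let kprecomp_prob x : kprecomp mf x [set: Z] = 1%E.
Proof. exact: prob_kernel. Qed.

HB.instance Definition _ := Kernel_isProbability.Build _ _ X Z R
  (kprecomp mf) kprecomp_prob.
End kprecomp.

End kernel_tools.

Section euclidean.
Variable R : realType.

Definition dot d (x y : 'rV[R]_d) : R := \sum_(i < d) x ord0 i * y ord0 i.

(* The library norm of a matrix is the sup norm; the paths are measured in the
   Euclidean one. *)
Definition sqnorm d (x : 'rV[R]_d) : R := dot x x.

End euclidean.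

Section borel_rV.
Variables (R : realType) (d : nat).

Definition rV_coord (i : 'I_d) (x : 'rV[R]_d) : R := x ord0 i.

(* The sigma-algebra generated by the coordinates, i.e. the Borel one on R^d. *)
Definition rV_measurable : set (set 'rV[R]_d) := g_sigma_preimage rV_coord.

Let rV_measurable0 : rV_measurable set0.
Proof. exact: sigma_algebra0. Qed.

Let rV_measurableC A : rV_measurable A -> rV_measurable (~` A).
Proof. exact: sigma_algebraC. Qed.

Let rV_measurable_bigcup (F : (set 'rV[R]_d)^nat) :
  (forall i, rV_measurable (F i)) -> rV_measurable (\bigcup_i (F i)).
Proof. exact: sigma_algebra_bigcup. Qed.

HB.instance Definition _ := @isMeasurable.Build
  default_measure_display 'rV[R]_d rV_measurable rV_measurable0 rV_measurableC rV_measurable_bigcup.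
End borel_rV.


Lemma measurable_rVP (R : realType) d d0 (X : measurableType d0)
    (f : X -> 'rV[R]_d) :
  (forall i, measurable_fun [set: X] (fun x => f x ord0 i)) ->
  measurable_fun [set: X] f.
Proof.
move=> mf; apply: (@measurability _ _ _ _ _ _ (\big[setU/set0]_(i < d)
  preimage_set_system setT (@rV_coord R d i) measurable)); first by [].
move=> _ [B + <-].
elim/big_ind: _ => [//|A1 A2 h1 h2 [/h1//|/h2//]|i _ [A mA <-]].
by rewrite !setTI; have := mf i measurableT A mA; rewrite setTI.
Qed.

Lemma measurable_coord (R : realType) d (i : 'I_d) :
  measurable_fun [set: 'rV[R]_d] (fun x => x ord0 i).
Proof.
move=> _ A mA; apply: sub_sigma_algebra.
rewrite -bigcup_seq/=; exists i => /=; first by rewrite mem_index_enum.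
by exists A.
Qed.

Section gaussian.
Variable R : realType.

Definition rV_cons d (p : measurableTypeR R * 'rV[R]_d) : 'rV[R]_d.+1 :=
  row_mx (const_mx p.1 : 'rV_1) p.2.

Lemma rV_cons_measurable d : measurable_fun [set: measurableTypeR R * 'rV[R]_d] (@rV_cons d).
Proof.
apply: measurable_rVP => i; case: (@split_ordP 1 d i) => j ->.
  rewrite (_ : (fun x => _) = fst) //; apply/funext => x.
  by apply: etrans (row_mxEl _ _ _ _) _; rewrite mxE.
rewrite (_ : (fun x => _) =  (fun x : measurableTypeR R * 'rV[R]_d => x.2 ord0 j)); last first.
  by apply/funext => x; exact: row_mxEr.
by apply: measurableT_comp (measurable_coord j) _.
Qed.

HB.instance Definition _ d := @isMeasurableFun.Build _ _ _ _
  (@rV_cons d) (@rV_cons_measurable d).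

(* The standard Gaussian N(0, I_d), one coordinate at a time; see
   [gaussian_box]. *)
Fixpoint gaussian d : probability 'rV[R]_d R :=
  match d with
  | 0 => \d_(0 : 'rV[R]_0)
  | d'.+1 => distribution (normal_prob 0 1 \x gaussian d')%E (@rV_cons d')
  end.

End gaussian.

Lemma gaussian_box (R : realType) d (A : 'I_d -> set (measurableTypeR R)) :
  (forall i, measurable (A i)) ->
  gaussian R d [set x : 'rV[R]_(_) | forall i, A i (x ord0 i)] =
  (\prod_(i < d) normal_prob 0 1 (A i))%E.
Proof.
elim: d A => [|d IH] A mA.
  rewrite big_ord0 /= diracE mem_set//; by case.
rewrite /= /distribution /pushforward.
have e : rV_cons (R:=R) (d:=d) @^-1` [set x : 'rV[R]_(_) | forall i, A i (x ord0 i)] =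
   A ord0 `*` [set x : 'rV[R]_d | forall i, A (lift ord0 i) (x ord0 i)].
  have e0 (p : measurableTypeR R * 'rV[R]_d) : rV_cons p ord0 ord0 = p.1.
    have E : (ord0 : 'I_d.+1) = (lshift d (ord0 : 'I_1)) by exact/val_inj.
    apply: etrans (congr1 (rV_cons p ord0) E) _.
    by apply: (etrans (row_mxEl _ _ _ _)); rewrite mxE.
  have e1 (p : measurableTypeR R * 'rV[R]_d) i : rV_cons p ord0 (lift ord0 i) = p.2 ord0 i.
    have E : lift ord0 i = rshift 1 i :> 'I_(1 + d) by exact/val_inj.
    by apply: etrans (congr1 (rV_cons p ord0) E) _; exact: row_mxEr.
  apply/seteqP; split => [p /= h|p /= [h0 h1] i].
    by split=> [|i]; [rewrite -e0|rewrite -e1].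
  by case: (unliftP ord0 i) => [j ->|->]; rewrite ?e1 ?e0.
have mB : measurable [set x : 'rV[R]_d | forall i, A (lift ord0 i) (x ord0 i)].
  rewrite (_ : [set _ | _] = \bigcap_(i in [set: 'I_d])
     ((fun x : 'rV[R]_d => x ord0 i) @^-1` A (lift ord0 i))).
    apply: fin_bigcap_measurable => // i _; rewrite -[X in measurable X]setTI.
    exact: (@measurable_coord R d i measurableT _ (mA _)).
  by apply/seteqP; split=> [x h i _|x h i]; exact: h.
rewrite e product_measure1E//.
rewrite big_ord_recl; congr (_ * _)%E.
by apply: (IH (fun i => A (lift ord0 i))) => i; exact: mA.
Qed.

Section ornstein_uhlenbeck.
Variables (R : realType) (d : nat) (omega : R).

Definition correlate (p : 'rV[R]_d * 'rV[R]_d) : 'rV[R]_d :=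
  omega *: p.1 + Num.sqrt (1 - omega ^+ 2) *: p.2.

Lemma correlate_measurable :
  measurable_fun [set: 'rV[R]_d * 'rV[R]_d] correlate.
Proof.
apply: measurable_rVP => i; under eq_fun do rewrite !mxE.
by apply: measurable_funD; apply: measurable_funM => //;
  apply: (measurableT_comp (measurable_coord i)).
Qed.

(* The law of u' ~_omega u, as a kernel in u. *)
Definition correlated : R.-pker 'rV[R]_d ~> 'rV[R]_d :=
  pkcomp (kprobability (measurable_cst (gaussian R d : pprobability _ R)))
         (kdirac correlate_measurable).

End ornstein_uhlenbeck.

(* A sequence of points (p_0, ..., p_l) is the pair of p_0 and [:: p_1; ...; p_l].
   Points of V are designated by their index in 'I_n.  That l >= 1 is part of
   [is_gmatching]. *)
Notation vpath n := ('I_n * seq 'I_n)%type.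

Section paths.
Variable n : nat.
Implicit Types p q : vpath n.

Definition pverts p : seq 'I_n := p.1 :: p.2.
Definition pfirst p : 'I_n := p.1.
Definition plast p : 'I_n := last p.1 p.2.
(* Only meaningful when [plast p = pfirst q]; the common point is kept once. *)
Definition pcat p q : vpath n := (p.1, p.2 ++ q.2).
Definition preverse p : vpath n := (plast p, rev (belast p.1 p.2)).

Lemma plast_pcat p q : plast p = pfirst q -> plast (pcat p q) = plast q.
Proof. by rewrite /plast /pcat/= last_cat => ->. Qed.

Lemma plast_preverse p : plast (preverse p) = pfirst p.
Proof.
case: p => x [//|y s]; rewrite /plast /preverse/= rev_cons last_rcons //.
Qed.

Lemma pverts_preverse p : pverts (preverse p) = rev (pverts p).
Proof. by case: p => x s; rewrite /pverts/= [in RHS]lastI rev_rcons. Qed.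

(* A generalized matching has at most n paths, so taking finite sets of paths
   loses nothing, and it makes the type of generalized matchings countable. *)
Definition is_gmatching (M : {fset vpath n}) : bool :=
  `[< [/\ {in M, forall p, p.2 != [::]},
          {in M &, injective pfirst} & {in M &, injective plast}] >].

Record gmatching := GMatching {
  gmpaths :> {fset vpath n};
  gmatchingP : is_gmatching gmpaths }.

HB.instance Definition _ := [isSub for gmpaths].
HB.instance Definition _ := [Countable of gmatching by <:].

Lemma gm0_subproof : is_gmatching fset0.
Proof. by apply/asboolP; split=> [p|p q|p q]; rewrite inE. Qed.

HB.instance Definition _ := isPointed.Build gmatching (GMatching gm0_subproof).

HB.instance Definition _ := @isMeasurable.Build default_measure_display
  gmatching discrete_measurable discrete_measurable0
  discrete_measurableC discrete_measurableU.

Lemma gmatching_sub (M : gmatching) (A : {fset vpath n}) :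
  (A `<=` gmpaths M)%fset -> is_gmatching A.
Proof.
case: M => M /asboolP[M1 M2 M3] /= /fsubsetP AM; apply/asboolP; split.
- by move=> p /AM; exact: M1.
- by move=> p q /AM ? /AM ?; exact: M2.
- by move=> p q /AM ? /AM ?; exact: M3.
Qed.

Definition gcomp_paths (M1 M2 : {fset vpath n}) : {fset vpath n} :=
  [fset pcat p q | p in M1, q in [fset q in M2 | plast p == pfirst q]]%fset.

Lemma gcomp_subproof (M1 M2 : gmatching) : is_gmatching (gcomp_paths M1 M2).
Proof.
have /asboolP[a1 a2 a3] := gmatchingP M1.
have /asboolP[b1 b2 b3] := gmatchingP M2.
have H r : r \in gcomp_paths M1 M2 ->
    exists p q, [/\ p \in gmpaths M1, q \in gmpaths M2, plast p = pfirst q & r = pcat p q].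
  case/imfset2P => p /= pM1 [q]; rewrite !inE/= => /andP[qM2 /eqP pq] ->.
  by exists p, q.
apply/asboolP; split.
- move=> _ /H[p [q [pM _ _ ->]]] /=; rewrite -size_eq0 size_cat addn_eq0.
  by rewrite negb_and size_eq0 (a1 p).
- move=> _ _ /H[p [q [pM qM pq ->]]] /H[p' [q' [p'M q'M pq' ->]]] /= e.
  have ep : p = p' by exact: a2.
  by rewrite ep in pq *; rewrite (b2 q q')// -pq.
- move=> _ _ /H[p [q [pM qM pq ->]]] /H[p' [q' [p'M q'M pq' ->]]].
  rewrite !plast_pcat// => e; have eq : q = q' by exact: b3.
  by rewrite eq in pq *; rewrite (a3 p p')// pq.
Qed.

Definition gcomp (M1 M2 : gmatching) : gmatching :=
  GMatching (gcomp_subproof M1 M2).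

Definition grev_paths (M : {fset vpath n}) : {fset vpath n} :=
  [fset preverse p | p in M]%fset.

Lemma grev_subproof (M : gmatching) : is_gmatching (grev_paths M).
Proof.
have /asboolP[a1 a2 a3] := gmatchingP M; apply/asboolP; split.
- move=> _ /imfsetP[p /= pM ->]; have := a1 p pM.
  by rewrite -!size_eq0 /= size_rev size_belast.
- by move=> _ _ /imfsetP[p /= pM ->] /imfsetP[q /= qM ->] /a3 ->.
- move=> _ _ /imfsetP[p /= pM ->] /imfsetP[q /= qM ->].
  by rewrite !plast_preverse => /a2 ->.
Qed.

Definition grev (M : gmatching) : gmatching := GMatching (grev_subproof M).

End paths.

Lemma measurable_fun_countable_snd (n : nat) d d' (X : measurableType d)
    (Z : measurableType d') (f : X * gmatching n -> Z) :
  (forall M, measurable_fun [set: X] (fun x => f (x, M))) ->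
  measurable_fun [set: X * gmatching n] f.
Proof.
move=> mf _ A mA; rewrite setTI.
pose F k := if (choice.unpickle k : option (gmatching n)) is Some M
  then ((fun x => f (x, M)) @^-1` A) `*` [set M]
  else set0.
rewrite (_ : _ @^-1` _ = \bigcup_k F k).
  apply: bigcupT_measurable => k; rewrite /F; case: choice.unpickle => // M.
  by apply: measurableX => //; rewrite -[X in measurable X]setTI; exact: mf.
apply/seteqP; split => [[x M] /= fA|[x M] [k _]].
  by exists (choice.pickle M) => //; rewrite /F choice.pickleK.
by rewrite /F; case: choice.unpickle => // M' [/= h ->].
Qed.

Section geometry.
Variables (R : realType) (d n : nat) (V : 'I_n -> 'rV[R]_d) (Delta : R).
Implicit Types p q : vpath n.

(* The sum of the squared lengths of the steps of p. *)
Definition pcost p : R :=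
  \sum_(c <- pairmap (fun x y => sqnorm (V y - V x)) p.1 p.2) c.

Definition pdisp p : 'rV[R]_d := V (plast p) - V (pfirst p).

Definition violating p : bool :=
  `[< exists q, [/\ infix (pverts q) (pverts p), q.2 != [::] &
                    pcost q <= sqnorm (pdisp q) - Delta] >].

Definition truncate_paths (s : R) (u : 'rV[R]_d) (M : {fset vpath n}) :=
  [fset p in M | violating p || (s <= dot (pdisp p) u)]%fset.

Lemma truncate_subproof (s : R) u (M : gmatching n) :
  is_gmatching (truncate_paths s u M).
Proof. by apply: gmatching_sub; exact: fset_sub. Qed.

Definition truncate (s : R) (uM : 'rV[R]_d * gmatching n) : gmatching n :=
  GMatching (truncate_subproof s uM.1 uM.2).

Lemma dot_measurable (x : 'rV[R]_d) : measurable_fun [set: 'rV[R]_d] (dot x).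
Proof.
apply: measurable_sum => i; apply: measurable_funM => //.
exact: measurable_coord.
Qed.

Lemma truncate_measurable (s : R) :
  measurable_fun [set: 'rV[R]_d * gmatching n] (truncate s).
Proof.
apply: measurable_fun_countable_snd => M _ A _; rewrite setTI.
pose B (N : gmatching n) :=
  \bigcap_(p in [set` gmpaths M])
    [set u : 'rV[R]_d | (violating p || (s <= dot (pdisp p) u))
                        = (p \in gmpaths N)].
have mB N : measurable (B N).
  apply: fin_bigcap_measurable => // p _.
  rewrite (_ : [set _ | _] = (fun u => violating p || (s <= dot (pdisp p) u))
    @^-1` [set (p \in gmpaths N)])//.
  rewrite -[X in measurable X]setTI.
  apply: (_ : measurable_fun [set: 'rV[R]_d] _) => //.
  apply: measurable_or => //; apply: measurable_fun_ler => //.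
  exact: dot_measurable.
rewrite (_ : _ @^-1` _ = \bigcup_k
   (if (choice.unpickle k : option (gmatching n)) is Some N then
     if `[< A N /\ (gmpaths N `<=` gmpaths M)%fset >] then B N else set0
    else set0)).
  by apply: bigcupT_measurable => k; case: choice.unpickle => // N; case: ifP.
apply/seteqP; split => [u /= Au|u [k _]].
  exists (choice.pickle (truncate s (u, M))) => //; rewrite choice.pickleK asboolT.
    by move=> p /= pM; rewrite !inE/= pM.
  by split => //; exact: fset_sub.
case: choice.unpickle => // N; case: asboolP => // -[AN /fsubsetP NM] BN /=.
rewrite (_ : truncate s (u, M) = N)//; apply/val_inj/fsetP => p /=.
rewrite !inE/=; have [pM|pM] := boolP (p \in gmpaths M); first exact: BN.
by apply/esym/negbTE; apply: contra pM; exact: NM.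
Qed.

End geometry.

(* Each u is assigned a distribution on the countable set of generalized
   matchings (with all its subsets measurable), measurably in u. *)
Notation matching_cover R d n :=
  (R.-pker 'rV[R]_d ~> gmatching n%N).

Section covers.
Variables (R : realType) (d n : nat).
Implicit Type C : matching_cover R d n.

Definition in_support C (u : 'rV[R]_d) (M : gmatching n) : Prop :=
  (0 < C u [set M])%E.

Definition cover_size C : \bar R :=
  ((n%:R^-1)%:E * \int[gaussian R d]_u \int[C u]_M (#|` gmpaths M|%:R)%:E)%E.

Definition skew_symmetric C : Prop :=
  forall u A, pushforward (C (- u)) (@grev n) A = C u A.

Definition stretched (V : 'I_n -> 'rV[R]_d) (Delta s : R) C : Prop :=
  forall u M p, in_support C u M -> p \in gmpaths M ->
    ~~ violating V Delta p -> s <= dot (pdisp V p) u.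

Definition khop (V : 'I_n -> 'rV[R]_d) (Delta : R) (k : nat) C : Prop :=
  forall u M p, in_support C u M -> p \in gmpaths M ->
    size p.2 = k /\ path (fun x y => sqnorm (V y - V x) <= Delta) p.1 p.2.

Definition truncated (V : 'I_n -> 'rV[R]_d) (Delta s : R) C :
    matching_cover R d n :=
  pkcomp C (kdirac (truncate_measurable V Delta s)).

Lemma gcomp_measurable :
  measurable_fun [set: 'rV[R]_d * gmatching n * 'rV[R]_d * gmatching n]
    (fun t => gcomp t.1.1.2 t.2).
Proof.
apply: measurable_fun_countable_snd => M' /=.
apply: (measurableT_comp (f := fun M => gcomp M M')) => //.
exact: measurableT_comp.
Qed.

(* [chain omega m C u] is the law of M_1 o (M_2 o ... o M_{m+1}): sample M_1 from
   C u, then u' ~_omega u, then M' from [chain omega (m - 1) C u'], and return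
   M_1 o M'.  Concatenation is associative; see [chainS]. *)
Fixpoint chain (omega : R) (m : nat) C : matching_cover R d n :=
  match m with
  | 0 => C
  | m'.+1 =>
      pkcomp C
     (pkcomp (kprecomp (correlated d omega) measurable_fst)
     (pkcomp (kprecomp (chain omega m' C) measurable_snd)
             (kdirac gcomp_measurable)))
  end.

Definition sample_paths (K : nat) C : matching_cover R d n :=
  chain (1 - K%:R^-1) K.-1 C.

End covers.

Lemma chainS (R : realType) d n om m (C : matching_cover R d n) u A :
  chain om m.+1 C u A =
  (\int[C u]_M \int[gaussian R d]_g
     \int[chain om m C (om *: u + Num.sqrt (1 - om ^+ 2) *: g)%R]_M'
       \d_(gcomp M M') A)%E.
Proof.
apply: eq_integral => M _.
pose F (y : 'rV[R]_d) := (\int[chain om m C y]_M' \d_(gcomp M M') A)%E.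
have mF : measurable_fun setT F.
  apply: (@measurable_fun_integral_kernel _ _ _ _ _ (chain om m C) _
    (fun M' => \d_(gcomp M M') A)) => // U mU; exact: measurable_kernel.
transitivity (\int[correlated d om u]_y F y)%E; first by [].
have F0 y : (0 <= F y)%E by apply: integral_ge0 => *.
apply: etrans (integral_kcomp _ _ _ F0 mF) _.
apply: eq_integral => g _ /=.
by rewrite integral_dirac// diracT mul1e.
Qed.

(* Main.v *)
(** Write S for one step of the matching and T for the Ornstein-Uhlenbeck step;
    a K-step path is then a walk S T S ... T S.

    Enough paths.  The walk is robust: deleting any small family of Gaussian
    sets from its starting points and, reflected, from its end points, leaves
    much mass.  Skew-symmetry makes the in-mass and the out-mass of a vertex
    mirror images of each other, so if the k-step walk is robust the set of
    directions in which a vertex has many continuations is large for many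
    vertices, and gluing two k-step walks by one T costs a factor given by
    reverse hypercontractivity, exp(-O(K)) for sets of constant measure.  Along
    K = 2^r the tolerances may decrease geometrically, and the logarithmic losses
    sum to O(K^2).

    Few bad paths.  Reading the walk backwards from its last vertex, the
    displacement in the direction of the first Gaussian gains sigma at each step,
    up to Gaussian errors of variance O(Delta) for nonviolating paths; each path
    has at most one extension, so an exponential moment bounds the expected
    number of paths of small stretch by n exp(-Omega(K^2 / (K Delta))), without
    any union bound.

    Reverse hypercontractivity tensorizes and is proved on the line: a
    dimension-free Harnack inequality is combined with Maurey's
    infimum-convolution inequality, which is a one-dimensional transport
    argument. *)

From HB Require Import structures.
Require Import Defs.
From mathcomp Require Import all_boot all_order all_algebra.
From mathcomp Require Import finmap.
From mathcomp Require Import all_classical all_reals all_analysis.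
From mathcomp Require Import measurable_realfun normal_distribution.
From mathcomp Require Import ring lra zify.

Set Implicit Arguments.
Unset Strict Implicit.
Unset Printing Implicit Defensive.

Import Order.TTheory GRing.Theory Num.Theory.
Import numFieldNormedType.Exports.

Local Open Scope classical_set_scope.
Local Open Scope ring_scope.

(** * The normal distribution on the line *)

(** A lower bound on the mass of walks cannot be doubled by itself: at each vertex the mass might
    sit on very few directions, and two halves glued there would meet only through tiny sets.
    Robustness rules this out, because directions with many continuations, were they rare, could
    themselves be deleted. The cost of gluing is a power [b.+2 + b.+1] of a measure, where
    [b.+1 = 2 * K] is forced by s^2 being of order 1/K. Each doubling squares the mass, so a loss of
    order K j at level j is counted 2^(r - j) times; halving the tolerance at every level
    contributes only the summable factor j. Good and bad paths are both counted up to a factor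
    exponential in K^2. The smallness of K Delta is what makes the second constant win, so c1 is
    fixed only after the constant of the first count is known. All exponents are natural numbers:
    Hoelder and reverse Hoelder inequalities both come from one polynomial Young inequality,
    integrated. *)

Section density.
Local Open Scope ereal_scope.
Context d (T : measurableType d) (R : realType).
Variables (mu nu : {measure set T -> \bar R}) (g : T -> R).
Hypotheses (mg : measurable_fun setT g) (g0 : forall x, (0 <= g x)%R).
Hypothesis nuE : forall A, measurable A -> nu A = \int[mu]_(x in A) (g x)%:E.

Import HBNNSimple.

Let integral_density_nnsfun (f : {nnsfun T >-> R}) :
  \int[nu]_x (f x)%:E = \int[mu]_x ((f x)%:E * (g x)%:E).
Proof.
under [LHS]eq_integral do rewrite fimfunE -fsumEFin//.
rewrite [LHS]ge0_integral_fsum//; last 2 first.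
  - by move=> r; exact/measurable_EFinP/measurableT_comp.
  - by move=> n x _; rewrite EFinM nnfun_muleindic_ge0.
under [RHS]eq_integral.
  move=> x _; rewrite fimfunE -fsumEFin// ge0_mule_fsuml; last first.
    by move=> r; rewrite EFinM nnfun_muleindic_ge0.
  over.
rewrite [RHS]ge0_integral_fsum//; last 2 first.
  - move=> r; apply: emeasurable_funM; last exact/measurable_EFinP.
    by apply/measurable_EFinP/measurable_funM => //; exact/measurable_indic.
  - move=> r x _; apply: mule_ge0; last by rewrite lee_fin.
    by rewrite EFinM nnfun_muleindic_ge0.
apply: eq_fsbigr => r _.
under eq_integral do rewrite EFinM.
rewrite integralZl_indic_nnsfun//= integral_indic// setIT.
rewrite nuE//.
under [RHS]eq_integral do rewrite EFinM -muleA.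
have [r0|r0] := leP 0%R r.
  rewrite ge0_integralZl//=; last 2 first.
  - by apply: emeasurable_funM => //; exact/measurable_EFinP.
  - by move=> x _; rewrite mule_ge0// lee_fin.
  congr (_ * _); rewrite integral_mkcond; apply: eq_integral => x _.
  by rewrite patchE indicE; case: ifP; rewrite ?mul1e ?mul0e.
rewrite preimage_nnfun0// integral_set0 mule0 integral0_eq// => x _.
by rewrite indic0 mul0e mule0.
Qed.

Lemma ge0_integral_density (f : T -> \bar R) :
  measurable_fun setT f -> (forall x, 0 <= f x) ->
  \int[nu]_x f x = \int[mu]_x (f x * (g x)%:E).
Proof.
move=> mf f0; pose f_ := nnsfun_approx measurableT mf.
transitivity (limn (fun n => \int[nu]_x (f_ n x)%:E)).
  rewrite -monotone_convergence//=.
  - apply: eq_integral => x xD; apply/esym/cvg_lim => //=.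
    exact: cvg_nnsfun_approx.
  - by move=> n; exact/measurable_EFinP/measurable_funTS.
  - by move=> n x _; rewrite lee_fin.
  - by move=> x _ a b ab; rewrite lee_fin; exact/lefP/nd_nnsfun_approx.
under eq_fun do rewrite integral_density_nnsfun.
rewrite -monotone_convergence//=.
- apply: eq_integral => x _; apply/cvg_lim => //=.
  by apply: cvgeZr => //; exact: cvg_nnsfun_approx.
- by move=> n; apply: emeasurable_funM; exact/measurable_EFinP.
- by move=> n x _; rewrite -EFinM lee_fin mulr_ge0.
- move=> x _ a b ab; rewrite -!EFinM lee_fin ler_wpM2r//.
  exact/lefP/nd_nnsfun_approx.
Qed.

End density.

Section normal.
Local Open Scope ereal_scope.
Variable R : realType.
Notation mu := (@lebesgue_measure R).

Definition gauss1 : probability (measurableTypeR R) R := @normal_prob R 0 1.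

Lemma ge0_integral_normal_prob (m s : R) (f : R -> \bar R) :
  measurable_fun setT f -> (forall x, 0 <= f x) ->
  \int[normal_prob m s]_x f x = \int[mu]_x (f x * (normal_pdf m s x)%:E).
Proof.
move=> mf f0.
apply: (@ge0_integral_density _ _ _ mu (normal_prob m s)) => //.
- exact: measurable_normal_pdf.
- exact: normal_pdf_ge0.
Qed.

Definition affine (a b : R) : measurableTypeR R -> measurableTypeR R :=
  fun x => (a * x + b)%R.

Lemma measurable_affine (a b : R) : measurable_fun setT (affine a b).
Proof. by apply: measurable_funD => //; exact: measurable_funM. Qed.

HB.instance Definition _ a b := @isMeasurableFun.Build _ _ _ _
  (affine a b) (measurable_affine a b).

(** Uniqueness of Lebesgue measure on half-open intervals identifies the scaled image measure, so
    [f] need only be measurable. *)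
Lemma ge0_integral_affine (a b : R) (f : R -> \bar R) : (0 < a)%R ->
  measurable_fun setT f -> (forall x, 0 <= f x) ->
  \int[mu]_x f x = \int[mu]_x (f (a * x + b)%R * a%:E).
Proof.
move=> a0 mf f0.
have a0' : (0 <= a)%R := ltW a0.
have E := @ge0_integral_pushforward _ _ _ _ R (affine a b) (measurable_affine a b)
  mu setT f measurableT mf (fun x _ => f0 x).
rewrite ge0_integralZr ?lee_fin//; last first.
  by apply: measurableT_comp => //; exact: measurable_affine.
rewrite muleC; move: E; rewrite preimage_setT => <-.
rewrite -(ge0_integral_mscale _ measurableT (NngNum a0'))//.
apply: eq_measure_integral => A mA _.
apply: lebesgue_measure_unique => // _ [[p q] _ <-].
apply: (@etrans _ _ (a%:E * mu (affine a b @^-1` `]p, q]))); last by [].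
rewrite (_ : _ @^-1` _ = `](p - b) / a, (q - b) / a]%classic)%R.
  rewrite !lebesgue_measure_itv/= !lte_fin ltr_pM2r ?invr_gt0// ltrD2r.
  case: ifPn => _; last by rewrite mule0.
  by rewrite -!EFinB -EFinM; congr EFin; field; rewrite gt_eqF.
apply/seteqP; split => x; rewrite /= /affine !in_itv/=;
  by rewrite ltr_pdivrMr// ler_pdivlMr// ltrBlDr lerBrDr mulrC.
Qed.

Lemma normal_pdf01 (x : R) : normal_pdf 0 1 x = (normal_peak 1 * expR (- (x ^+ 2 / 2)))%R.
Proof.
by rewrite normal_pdfE ?oner_eq0// /normal_fun subr0 expr1n mulNr.
Qed.

Lemma measurable_expR_affine (h c : R) : measurable_fun setT (fun z : R => expR (h * z + c)).
Proof. by apply: measurableT_comp => //; apply: measurable_funD => //; exact: measurable_funM. Qed.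

(** Substituting z = x + h moves the shift onto the density, and the quotient of the two densities
    is the exponential factor. *)
Lemma cameron_martin (h : R) (f : R -> \bar R) :
  measurable_fun setT f -> (forall x, 0 <= f x) ->
  \int[gauss1]_z f (z + h)%R =
  \int[gauss1]_z (f z * (expR (h * z - h ^+ 2 / 2))%:E).
Proof.
move=> mf f0.
have mfh : measurable_fun setT (fun z : R => f (z + h)%R).
  by apply: measurableT_comp => //; exact: measurable_funD.
have me : measurable_fun setT (fun z : R => (f z * (expR (h * z - h ^+ 2 / 2))%:E)).
  by apply: emeasurable_funM => //; apply/measurable_EFinP; exact: measurable_expR_affine.
rewrite ge0_integral_normal_prob// (ge0_integral_normal_prob _ _ me); last first.
  by move=> x; rewrite mule_ge0// lee_fin expR_ge0.
rewrite [RHS](ge0_integral_affine h ltr01); last 2 first.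
- apply: emeasurable_funM => //; apply/measurable_EFinP.
  exact: measurable_normal_pdf.
- by move=> x; rewrite !mule_ge0// lee_fin ?expR_ge0// normal_pdf_ge0.
apply: eq_integral => x _.
rewrite mule1 mul1r -muleA; congr (_ * _).
rewrite -EFinM; congr EFin; rewrite !normal_pdf01 mulrCA -expRD.
by congr (_ * expR _)%R; field.
Qed.

Lemma normal_mgf (h : R) :
  \int[gauss1]_z (expR (h * z))%:E = (expR (h ^+ 2 / 2))%:E.
Proof.
have := @cameron_martin h (cst 1) (measurable_cst _) (fun=> lee01).
rewrite integral_cst//= probability_setT mule1 => /(congr1 (fun x => (expR (h ^+ 2 / 2))%:E * x)).
rewrite mule1 => {1}->.
rewrite -ge0_integralZl ?lee_fin ?expR_ge0//; last first.
  apply: emeasurable_funM => //; apply/measurable_EFinP.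
  exact: measurable_expR_affine.
apply: eq_integral => x _; rewrite /= mul1e -EFinM -expRD.
by congr (expR _)%:E; lra.
Qed.

Lemma ge0_integral_normalN (f : R -> \bar R) :
  measurable_fun setT f -> (forall x, 0 <= f x) ->
  \int[gauss1]_z f (- z)%R = \int[gauss1]_z f z.
Proof.
move=> mf f0.
have mfN : measurable_fun setT (fun z : R => f (- z)%R) by exact: measurableT_comp.
rewrite !ge0_integral_normal_prob//.
have mF : measurable_fun [set: R] (fun x => f x * (normal_pdf 0 1 x)%:E).
  by apply: emeasurable_funM => //; apply/measurable_EFinP; exact: measurable_normal_pdf.
set F := (fun x => _) in mF.
have F0 x : 0 <= F x by rewrite mule_ge0// lee_fin normal_pdf_ge0.
have mN : measurable_fun setT (-%R : measurableTypeR R -> measurableTypeR R) by [].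
have E := @ge0_integral_pushforward _ _ _ _ R _ mN mu setT F measurableT mF
  (fun x _ => F0 x).
transitivity (\int[mu]_x (F \o -%R) x).
  by apply: eq_integral => x _; rewrite /F/= !normal_pdf01 sqrrN.
move: E; rewrite preimage_setT => <-.
by apply: eq_measure_integral => A mA _; exact: lebesgue_measureN.
Qed.

(** Reversibility of the Ornstein-Uhlenbeck step: the pair (x, w x + s z) has joint density [k],
    which is symmetric because w^2 + s^2 = 1. *)
Lemma ou_exchange1 (w s : R) (f : R * R -> \bar R) : (0 < s)%R -> (w ^+ 2 + s ^+ 2 = 1)%R ->
  measurable_fun setT f -> (forall x, 0 <= f x) ->
  \int[gauss1]_x \int[gauss1]_z f (x, w * x + s * z)%R =
  \int[gauss1]_x \int[gauss1]_z f (w * x + s * z, x)%R.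
Proof.
move=> s0 ws mf f0.
pose k (x y : R) : R := (normal_pdf 0 1 x * normal_pdf 0 1 ((y - w * x) / s) / s)%R.
have k0 x y : (0 <= k x y)%R by rewrite !mulr_ge0 ?normal_pdf_ge0// invr_ge0 ltW.
have kC x y : k x y = k y x.
  rewrite /k !normal_pdf01; congr (_ / _)%R.
  rewrite mulrACA [RHS]mulrACA -!expRD; congr (_ * expR _)%R.
  suff : (((y - w * x) / s) ^+ 2 - ((x - w * y) / s) ^+ 2 = y ^+ 2 - x ^+ 2)%R.
    by lra.
  have -> : (((y - w * x) / s) ^+ 2 - ((x - w * y) / s) ^+ 2 =
      (1 - w ^+ 2) / s ^+ 2 * (y ^+ 2 - x ^+ 2))%R.
    by field; rewrite gt_eqF.
  have -> : (1 - w ^+ 2 = s ^+ 2)%R by rewrite -ws; ring.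
  by rewrite divff ?mul1r// expf_neq0// gt_eqF.
have mk : measurable_fun setT (fun p : R * R => k p.1 p.2).
  apply: measurable_funM => //; apply: measurable_funM.
    by apply: measurableT_comp => //; exact: measurable_normal_pdf.
  apply: (@measurableT_comp _ _ _ _ _ _ (normal_pdf 0 1)); first exact: measurable_normal_pdf.
  by apply: measurable_funM => //; apply: measurable_funB => //; apply: measurable_funM.
have E (h : R * R -> \bar R) : measurable_fun setT h -> (forall x, 0 <= h x) ->
    \int[gauss1]_x \int[gauss1]_z h (x, w * x + s * z)%R =
    \int[mu]_x \int[mu]_y (h (x, y) * (k x y)%:E).
  move=> mh h0.
  have mg : measurable_fun setT (fun p : R * R => h (p.1, w * p.1 + s * p.2)%R).
    apply: measurableT_comp => //; apply: measurable_fun_pair => //.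
    by apply: measurable_funD; apply: measurable_funM.
  rewrite ge0_integral_normal_prob; last 2 first.
  - exact: (measurable_fun_fubini_tonelli_F (m2 := gauss1) _ mg).
  - by move=> x; exact: integral_ge0.
  apply: eq_integral => x _.
  have mhx : measurable_fun setT (fun z : R => h (x, w * x + s * z)%R).
    exact: (measurableT_comp mg (measurable_pair1 x)).
  rewrite ge0_integral_normal_prob// -ge0_integralZr//; last 3 first.
  - by apply: emeasurable_funM => //; apply/measurable_EFinP; exact: measurable_normal_pdf.
  - by move=> y _; rewrite mule_ge0// lee_fin normal_pdf_ge0.
  - by rewrite lee_fin normal_pdf_ge0.
  rewrite [RHS](ge0_integral_affine (w * x)%R s0); last 2 first.
  - apply: emeasurable_funM; last apply/measurable_EFinP.
      exact: (measurableT_comp mh (measurable_pair1 x)).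
    exact: (measurableT_comp mk (measurable_pair1 x)).
  - by move=> y; rewrite mule_ge0// lee_fin.
  apply: eq_integral => y _.
  rewrite (addrC (s * y)%R) -!muleA; congr (_ * _); rewrite -!EFinM; congr EFin.
  rewrite /k addrAC subrr add0r mulrC.
  have -> : (s * y / s = y)%R by field; rewrite gt_eqF.
  by field; rewrite gt_eqF.
have mf' : measurable_fun setT (fun p : R * R => f (p.2, p.1)).
  by apply: measurableT_comp => //; exact: measurable_fun_pair.
apply: etrans (E f mf f0) _; apply: etrans _ (esym (E _ mf' (fun _ => f0 _))).
under [RHS]eq_integral do under eq_integral do rewrite kC.
apply: (fubini_tonelli (m1 := mu) (m2 := mu) (fun p => f p * (k p.1 p.2)%:E)).
- by apply: emeasurable_funM => //; exact/measurable_EFinP.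
- by move=> p; rewrite mule_ge0// lee_fin.
Qed.

End normal.

(** * Monotone transport and Maurey's inequality *)

Section transport.
Variable R : realType.
Implicit Types (a b f u v phi : R -> R) (p q : R).

Lemma is_derive_gt0_lt f u : (forall x : R, is_derive x 1 f (u x)) ->
  (forall x, 0 < u x) -> {homo f : x y / x < y}.
Proof.
move=> df u0 x y xy.
have cf : {within `[x, y], continuous f}.
  by apply: derivable_within_continuous => z _; exact: ex_derive.
have [c _ fE] := MVT xy (fun z _ => df z) cf.
by rewrite -subr_gt0 fE mulr_gt0// subr_gt0.
Qed.

Lemma is_derive_continuous f (x l : R) : is_derive x 1 f l -> {for x, continuous f}.
Proof.
by move=> h; apply/differentiable_continuous/derivable1_diffP; exact: ex_derive.
Qed.

(* If y(x) is the monotone map carrying the density u to the density v, then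
   y' = (B/A) u / v and, by AM-GM, the midpoint z = (x + y(x)) / 2 satisfies
   phi(z) z' >= phi(z) sqrt(y') >= sqrt(B/A) u. *)
Lemma transport_primitive a b f u v phi p q :
  (forall x : R, is_derive x 1 a (u x)) -> (forall x : R, is_derive x 1 b (v x)) ->
  (forall x : R, is_derive x 1 f (phi x)) ->
  (forall x, 0 < u x) -> (forall x, 0 < v x) -> (forall x, 0 <= phi x) ->
  (forall x y, u x * v y <= phi ((x + y) / 2) ^+ 2) -> p < q ->
  (a q - a p) * (b q - b p) <= (f q - f p) ^+ 2.
Proof.
move=> da db df u0 v0 phi0 uvphi pq.
have a_lt := is_derive_gt0_lt da u0; have b_lt := is_derive_gt0_lt db v0.
have b_inj : injective b.
  move=> x y bxy; apply/eqP; case: (ltgtP x y) => // /b_lt;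
  by rewrite bxy ltxx.
(* [b] need not be onto; [g] inverts it on its range, and only its behaviour near values of [b] is
   used. *)
pose g (w : R) : R := @xget R 0 [set y | b y = w].
have bK : cancel b g.
  by move=> y; apply: b_inj; apply: (@xgetPex R 0 [set z | b z = b y]); exists y.
set A := a q - a p; set B := b q - b p.
have A0 : 0 < A by rewrite subr_gt0 a_lt.
have B0 : 0 < B by rewrite subr_gt0 b_lt.
pose c := B / A; have c0 : 0 < c by rewrite divr_gt0.
(* The value that [b] must take at the image of x: the fraction of [u]-mass between p and x equals
   the fraction of [v]-mass between p and the image. *)
pose t x := c * (a x - a p) + b p.
have dt (x : R) : is_derive x 1 t (c * u x).
  by apply: is_derive_eq; rewrite ?addr0 ?subr0 /GRing.scale/=; ring.
have tb x : x \in `[p, q]%R -> exists2 y, y \in `[p, q]%R & b y = t x.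
  rewrite in_itv/= => /andP[px xq]; apply: IVT; first exact: ltW.
    by apply: derivable_within_continuous => z _; exact: ex_derive.
  have bpq := b_lt _ _ pq.
  rewrite min_l ?max_r ?(ltW bpq)//; apply/andP; split.
    rewrite /t lerDr mulr_ge0 ?(ltW c0)// subr_ge0.
    by move: px; rewrite le_eqVlt => /predU1P[->//|/a_lt/ltW].
  rewrite /t -lerBrDr /c mulrAC ler_pdivrMr// ler_wpM2l ?(ltW B0)// lerD2r.
  by move: xq; rewrite le_eqVlt => /predU1P[->//|/a_lt/ltW].
pose y (x : R) : R := g (t x).
have yE x : x \in `[p, q]%R -> b (y x) = t x.
  by move=> /tb[z _ bz]; rewrite /y -bz bK.
have dy (x : R) : x \in `[p, q]%R -> is_derive x 1 y (c * u x / v (y x)).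
  move=> xpq; have dg : is_derive (b (y x)) 1 g (v (y x))^-1.
    apply: is_derive_inverse.
    - by near=> z; exact: bK.
    - by near=> z; exact: (is_derive_continuous (db z)).
    - by rewrite gt_eqF.
  rewrite yE// in dg.
  by have := is_derive1_comp dg (dt x); rewrite mulrC.
pose z (x : R) : R := (x + y x) / 2.
(* [D] is nondecreasing, and the transport fixes p and q, so D p <= D q reads sqrt(A B) <= f q - f
   p. *)
pose D x := f (z x) - Num.sqrt c * a x.
pose dD x := phi (z x) * ((1 + c * u x / v (y x)) / 2) - Num.sqrt c * u x.
have dDE (x : R) : x \in `[p, q]%R -> is_derive x 1 D (dD x).
  move=> xpq; have dyx := dy x xpq.
  have dz : is_derive x 1 z ((1 + c * u x / v (y x)) / 2).
    by apply: is_derive_eq; rewrite /GRing.scale/= !(mulr0, addr0, add0r) mulrC.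
  have dfz := is_derive1_comp (df (z x)) dz.
  by apply: is_derive_eq; rewrite /GRing.scale/= ?mulr0 ?addr0.
have dD0 x : x \in `[p, q]%R -> 0 <= dD x.
  move=> xpq; rewrite /dD subr_ge0.
  set w := v (y x).
  have w0 : 0 < w by exact: v0.
  have ux := u0 x.
  have r0 : 0 <= c * u x / w.
    by apply: divr_ge0; [apply: mulr_ge0|]; apply: ltW.
  have h1 : Num.sqrt (c * u x / w) <= (1 + c * u x / w) / 2.
    have := sqr_ge0 (1 - Num.sqrt (c * u x / w)); have := sqr_sqrtr r0.
    by lra.
  apply: le_trans (ler_wpM2l (phi0 (z x)) h1).
  rewrite -[leLHS]ger0_norm ?mulr_ge0 ?sqrtr_ge0 ?(ltW ux)// -sqrtr_sqr.
  rewrite -{1}(ger0_norm (phi0 (z x))) -sqrtr_sqr -sqrtrM ?sqr_ge0// ler_sqrt; last first.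
    by rewrite mulr_ge0 ?sqr_ge0.
  rewrite exprMn sqr_sqrtr ?(ltW c0)// [leRHS]mulrA ler_pdivlMr//.
  have -> : c * u x ^+ 2 * w = c * u x * (u x * w) by ring.
  rewrite [leLHS]mulrC; apply: ler_wpM2r; last exact: uvphi.
  exact: mulr_ge0 (ltW c0) (ltW ux).
have Dpq : D p <= D q.
  have pqi x : x \in `]p, q[%R -> x \in `[p, q]%R by exact: subset_itv_oo_cc.
  apply: (@ger0_derive1_le_cc _ D p q); rewrite ?in_itv/= ?lexx ?ltW//.
  - by move=> x /pqi /dDE h; exact: ex_derive.
  - by move=> x /pqi xpq; have h := dDE x xpq; rewrite derive1E derive_val dD0.
  - by apply: derivable_within_continuous => x /dDE h; exact: ex_derive.
have yp : y p = p.
  by rewrite /y /t subrr mulr0 add0r bK.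
have yq : y q = q.
  by rewrite /y /t /c -/A divfK ?gt_eqF// subrK bK.
move: Dpq; rewrite /D /z yp yq.
have half (x : R) : (x + x) / 2 = x by field.
rewrite !half => h; have {h} : Num.sqrt c * A <= f q - f p.
  by rewrite /A mulrBr; lra.
move=> h; have : (Num.sqrt c * A) ^+ 2 <= (f q - f p) ^+ 2.
  rewrite ler_pXn2r// nnegrE ?mulr_ge0 ?sqrtr_ge0 ?(ltW A0)//.
  by apply: le_trans h; rewrite mulr_ge0 ?sqrtr_ge0 ?(ltW A0).
rewrite exprMn sqr_sqrtr ?(ltW c0)//; apply: le_trans.
by rewrite /c [leRHS](_ : _ = A * B)//; field; rewrite gt_eqF.
Unshelve. all: by end_near.
Qed.

End transport.

Section maurey.
Variable R : realType.
Notation mu := (@lebesgue_measure R).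
Implicit Types u U V : R -> R.

Definition primitive u (x : R) : R := \int[mu]_(t in `]-oo, x]) u t.

Lemma is_derive_primitive u : mu.-integrable setT (EFin \o u) -> continuous u ->
  forall x : R, is_derive x 1 (primitive u) (u x).
Proof.
move=> iu cu x.
have xx1 : x < x + 1 by rewrite ltrDl.
have iux : mu.-integrable `]-oo, (x + 1)%R] (EFin \o u) by exact: integrableS iu.
have [d d1] := @continuous_FTC1 R u -oo%O x (x + 1) xx1 iux (ltNyr _) (cu x).
by apply: DeriveDef; [exact: d|rewrite -derive1E; exact: d1].
Qed.

Lemma primitiveB u (p q : R) : mu.-integrable setT (EFin \o u) -> p <= q ->
  primitive u q - primitive u p = \int[mu]_(t in `]p, q]) u t.
Proof.
move=> iu pq; rewrite /primitive Rintegral_itvB//.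
exact: integrableS iu.
Qed.

(** The transport argument lives on a bounded interval; here the intervals exhaust the line. *)
Lemma cvg_integral_itv u : mu.-integrable setT (EFin \o u) -> (forall x, 0 <= u x) ->
  (primitive u n%:R - primitive u (- n%:R))%:E @[n --> \oo] -->
    (\int[mu]_x (u x)%:E)%E.
Proof.
move=> iu u0.
have E (n : nat) : (primitive u n%:R - primitive u (- n%:R))%:E =
    (\int[mu]_x ((EFin \o u) \_ `](- n%:R)%R, n%:R]) x)%E.
  rewrite primitiveB//; last by rewrite (@le_trans _ _ 0) ?oppr_le0.
  rewrite -integral_mkcond /Rintegral fineK//.
  by apply: integrable_fin_num => //; exact: integrableS iu.
under eq_fun do rewrite E.
rewrite (_ : (\int[mu]_x (u x)%:E)%E =
   \int[mu]_x limn (fun n : nat => ((EFin \o u) \_ `](- n%:R)%R, n%:R]) x))%E; last first.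
  apply: eq_integral => x _; apply/esym/cvg_lim => //.
  apply: cvg_near_cst; near=> n.
  rewrite patchE mem_set//= in_itv/=; apply/andP.
  suff : `|x| < n%:R by rewrite ltr_norml => /andP[-> /ltW].
  near: n; exact: nbhs_infty_gtr.
apply: cvg_monotone_convergence => //.
- move=> n; apply/(measurable_restrictT (EFin \o u) (measurable_itv _)).
  by case/integrableP : iu => miu _; exact: measurable_funTS.
- by move=> n x _; apply: erestrict_ge0 => y _; rewrite /= lee_fin.
- move=> x _ m n mn; rewrite !patchE; case: ifPn => [|_]; last first.
    by case: ifPn => // _; rewrite /= lee_fin.
  rewrite inE/= in_itv/= => /andP[h1 h2].
  rewrite ifT// inE/= in_itv/=; apply/andP; split.
    by apply: le_lt_trans h1; rewrite lerN2 ler_nat.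
  by apply: le_trans h2 _; rewrite ler_nat.
Unshelve. all: by end_near. Qed.

Lemma normal_pdf_gt0 (x : R) : 0 < normal_pdf 0 1 x.
Proof. by rewrite normal_pdf01 mulr_gt0 ?expR_gt0// normal_peak_gt0 ?oner_neq0. Qed.

(* The infimum-convolution inequality of Maurey, in the form obtained from
   Prekopa-Leindler applied to U phi, V phi and phi. *)
Lemma maurey U V (M : R) : continuous U -> continuous V ->
  (forall x, 0 < U x) -> (forall x, 0 < V x) ->
  (forall x, U x <= M) -> (forall x, V x <= M) ->
  (forall x y, U x * V y <= expR ((x - y) ^+ 2 / 4)) ->
  ((\int[gauss1 R]_x (U x)%:E) * (\int[gauss1 R]_x (V x)%:E) <= 1)%E.
Proof.
move=> cU cV U0 V0 UM VM UV.
pose phi := @normal_pdf R 0 1.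
have cphi : continuous phi by apply: continuous_normal_pdf; exact: oner_neq0.
have iphi : mu.-integrable setT (EFin \o phi) by exact: integrable_normal_pdf.
have key (W : R -> R) : continuous W -> (forall x, 0 < W x) -> (forall x, W x <= M) ->
    [/\ continuous (W \* phi), mu.-integrable setT (EFin \o (W \* phi)),
     (forall x, 0 < W x * phi x) &
     (\int[gauss1 R]_x (W x)%:E = \int[mu]_x ((W \* phi) x)%:E)%E].
  move=> cW W0 WM; have cWphi : continuous (W \* phi) by move=> x; apply: cvgM; [exact: cW|exact: cphi].
  have mW : measurable_fun setT W by exact: continuous_measurable_fun.
  split => //.
  - apply: (@le_integrable _ _ _ mu _ measurableT _ (fun x => M%:E * (phi x)%:E)%E) => //.
    + by apply/measurable_EFinP; exact: continuous_measurable_fun.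
    + move=> x _ /=; rewrite lee_fin !normrM ler_wpM2r// ger0_norm ?(ltW (W0 x))//.
      exact: le_trans (WM x) (ler_norm _).
    + exact: integrableZl.
  - by move=> x; rewrite mulr_gt0// normal_pdf_gt0.
  - rewrite /gauss1 ge0_integral_normal_prob//; first exact/measurable_EFinP.
    by move=> x; rewrite lee_fin ltW.
have [cu iu u0 ->] := key U cU U0 UM.
have [cv iv v0 ->] := key V cV V0 VM.
have F (n : nat) : ((primitive (U \* phi) n%:R - primitive (U \* phi) (- n%:R))%:E *
    (primitive (V \* phi) n%:R - primitive (V \* phi) (- n%:R))%:E <= 1)%E.
  rewrite -EFinM lee_fin.
  have [->|n0] := eqVneq n 0; first by rewrite oppr0 !subrr mul0r.
  have nn : - n%:R < n%:R :> R by rewrite gtrN// ltr0n lt0n.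
  apply: (@le_trans _ _ ((primitive phi n%:R - primitive phi (- n%:R)) ^+ 2)).
    apply: (@transport_primitive _ _ _ _ (U \* phi) (V \* phi) phi) => //.
    - exact: is_derive_primitive.
    - exact: is_derive_primitive.
    - exact: is_derive_primitive.
    - by move=> x; rewrite ltW// normal_pdf_gt0.
    - move=> x y /=; rewrite /phi !normal_pdf01.
      set c := normal_peak 1.
      rewrite [leRHS](_ : _ = expR ((x - y) ^+ 2 / 4) * (c * expR (- (x ^+ 2 / 2)) * (c * expR (- (y ^+ 2 / 2))))).
        rewrite mulrACA; apply: ler_wpM2r => //.
        by rewrite !mulr_ge0 ?expR_ge0// normal_peak_ge0.
      (* The parallelogram identity between x, y and their midpoint: this is where the constant 1/4
         in the hypothesis comes from. *)
      have E : expR (- (((x + y) / 2) ^+ 2 / 2)) ^+ 2 = expR ((x - y) ^+ 2 / 4) *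
          (expR (- (x ^+ 2 / 2)) * expR (- (y ^+ 2 / 2))).
        by rewrite expr2 -!expRD; congr expR; field.
      by rewrite exprMn E; ring.
  rewrite expr_le1// primitiveB ?(ltW nn)//; last first.
    by apply: Rintegral_ge0 => x _; rewrite ltW// normal_pdf_gt0.
  rewrite -lee_fin /Rintegral fineK; last first.
    by apply: integrable_fin_num => //; exact: integrableS iphi.
  rewrite -(integral_normal_pdf 0 1); apply: ge0_subset_integral => //.
  - by case/integrableP : iphi.
  - by move=> x _; rewrite lee_fin ltW// normal_pdf_gt0.
have Fu := cvg_integral_itv iu (fun x => ltW (u0 x)).
have Fv := cvg_integral_itv iv (fun x => ltW (v0 x)).
have fin (W : R -> R) : mu.-integrable setT (EFin \o W) -> (\int[mu]_x (W x)%:E)%E \is a fin_num.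
  by move=> iW; exact: integrable_fin_num iW.
apply: (cvge_to_le (cvgeM _ Fu Fv)); last by near=> n; exact: F.
by rewrite -(fineK (fin _ iu)) -(fineK (fin _ iv)).
Unshelve. all: by end_near. Qed.

End maurey.

(** * Reverse hypercontractivity on the line *)

Section holder.
Variable R : realType.

(** Weighted AM-GM with integer exponents. The induction step is the hypothesis times a plus a
    nonnegative multiple of (t - a)^2. *)
Lemma young_exp (n : nat) (a t : R) : 0 <= a -> 0 <= t ->
  n.+1%:R * (a * t ^+ n) <= a ^+ n.+1 + n%:R * t ^+ n.+1.
Proof.
move=> a0 t0; elim: n => [|n IH]; first by rewrite expr0 mulr1 mul1r expr1 mul0r addr0.
have := ler_wpM2l a0 IH.
have : 0 <= n.+1%:R * t ^+ n * (t - a) ^+ 2.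
  by rewrite mulr_ge0 ?sqr_ge0// mulr_ge0// exprn_ge0.
rewrite !exprS -(natr1 n.+1) -(natr1 n).
by move: (t ^+ n) (a ^+ n) (n%:R) => T A N h0 h1; nra.
Qed.

Context d (T : measurableType d) (mu : {measure set T -> \bar R}).

(** The pointwise inequality is linear in the three functions, hence survives integration for every
    fixed l, and l = A / B is then the best choice. Leaving it as a hypothesis lets one lemma serve
    both Hoelder, in [harnack], and reverse Hoelder, in [reverse_hypercontractivity1]. *)
Lemma hoelder_young (n : nat) (f1 f2 f3 : T -> R) (A B C : R) :
  measurable_fun setT f1 -> measurable_fun setT f2 -> measurable_fun setT f3 ->
  (forall x, 0 <= f1 x) -> (forall x, 0 <= f2 x) -> (forall x, 0 <= f3 x) ->
  (forall x l, 0 <= l ->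
    n.+1%:R * l ^+ n * f2 x <= f1 x + n%:R * l ^+ n.+1 * f3 x) ->
  0 <= A -> 0 < B ->
  (\int[mu]_x (f2 x)%:E = A%:E)%E -> (\int[mu]_x (f3 x)%:E = B%:E)%E ->
  (\int[mu]_x (f1 x)%:E = C%:E)%E ->
  A ^+ n.+1 <= C * B ^+ n.
Proof.
move=> mf1 mf2 mf3 f10 f20 f30 yg A0 B0 eA eB eC.
pose l := A / B; have l0 : 0 <= l by rewrite divr_ge0// ltW.
have : ((n.+1%:R * l ^+ n)%:E * A%:E <= C%:E + (n%:R * l ^+ n.+1)%:E * B%:E)%E.
  have c1 : 0 <= n.+1%:R * l ^+ n by rewrite mulr_ge0// exprn_ge0.
  have c2 : 0 <= n%:R * l ^+ n.+1 by rewrite mulr_ge0// exprn_ge0.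
  rewrite -eA -eB -eC -!ge0_integralZl_EFin//; try exact/measurable_EFinP;
    try by move=> x _; rewrite lee_fin.
  rewrite -ge0_integralD//; last 4 first.
  - by move=> x _; rewrite lee_fin.
  - exact/measurable_EFinP.
  - by move=> x _; rewrite mule_ge0// lee_fin.
  - by apply: measurable_funeM; exact/measurable_EFinP.
  apply: ge0_le_integral => //.
  - by move=> x _; rewrite -EFinM lee_fin mulr_ge0.
  - by apply: measurable_funeM; exact/measurable_EFinP.
  - apply: emeasurable_funD; first exact/measurable_EFinP.
    by apply: measurable_funeM; exact/measurable_EFinP.
  - by move=> x _; rewrite -!EFinM -EFinD lee_fin; exact: yg.
rewrite -!EFinM -EFinD lee_fin => h.
have lB : l * B = A by rewrite /l divfK// gt_eqF.
have {}h : l ^+ n * A <= C.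
  have E : n%:R * l ^+ n.+1 * B = n%:R * (l ^+ n * A) by rewrite exprSr -lB; ring.
  by move: h; rewrite E -(natr1 n); lra.
rewrite exprS -{2}lB exprMn mulrA ler_wpM2r ?exprn_ge0 ?(ltW B0)//.
by rewrite mulrC.
Qed.

End holder.

Section ou1.
Variable R : realType.
Implicit Types (F G : R -> R) (w s : R).
Notation gam := (gauss1 R).

Definition ou1 w s G (x : R) : R := \int[gam]_z G (w * x + s * z).

(** A positive e is required of the second function in reverse hypercontractivity: it keeps the
    negative power [U] of [Q] bounded. Indicators are reached later by letting e tend to 0. *)
Definition unitf d (T : measurableType d) (e : R) (G : T -> R) :=
  measurable_fun setT G /\ forall x, e <= G x <= 1.

Lemma unitf_integral d (T : measurableType d) (P : probability T R) (f : T -> R) :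
  measurable_fun setT f -> (forall x, 0 <= f x <= 1) ->
  ((\int[P]_x f x)%R%:E = \int[P]_x (f x)%:E)%E.
Proof.
move=> mf f01; rewrite /Rintegral fineK//.
apply: integrable_fin_num => //.
apply: (@le_integrable _ _ _ P _ measurableT _ (cst 1%:E)) => //.
- exact/measurable_EFinP.
- move=> x _ /=; rewrite lee_fin normr1 ger0_norm; first by case/andP: (f01 x).
  by case/andP: (f01 x).
- exact: finite_measure_integrable_cst.
Qed.

Lemma integral_prob_cst d (T : measurableType d) (P : probability T R) (r : R) :
  (\int[P]_x r%:E = r%:E)%E.
Proof. by rewrite integral_cst//= probability_setT mule1. Qed.

Lemma Rintegral_unit d (T : measurableType d) (P : probability T R) (f : T -> R) e :
  measurable_fun setT f -> 0 <= e -> (forall x, e <= f x <= 1) ->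
  e <= (\int[P]_x f x)%R <= 1.
Proof.
move=> mf e0 fe1.
have f01 x : 0 <= f x <= 1 by have /andP[/(le_trans e0)-> ->] := fe1 x.
rewrite -!lee_fin unitf_integral// -{1}(integral_prob_cst P e) -(integral_prob_cst P 1).
apply/andP; split; apply: ge0_le_integral => //; try exact/measurable_EFinP.
- by move=> x _; rewrite lee_fin; case/andP: (fe1 x).
- by move=> x _; rewrite lee_fin; case/andP: (f01 x).
- by move=> x _; rewrite lee_fin; case/andP: (f01 x).
Qed.

Lemma measurable_ou1_arg w s G (x : R) : measurable_fun setT G ->
  measurable_fun setT (fun z : R => G (w * x + s * z)).
Proof.
move=> mG; apply: measurableT_comp => //.
by apply: measurable_funD => //; exact: measurable_funM.
Qed.

Lemma ou1E w s G x : unitf 0 G ->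
  ((ou1 w s G x)%:E = \int[gam]_z (G (w * x + s * z)%R)%:E)%E.
Proof.
by move=> [mG G01]; rewrite /ou1 unitf_integral//; exact: measurable_ou1_arg.
Qed.

Lemma ou1_bounds w s G x (e : R) : 0 <= e -> unitf e G -> e <= ou1 w s G x <= 1.
Proof.
by move=> e0 [mG Ge1]; apply: Rintegral_unit => //; exact: measurable_ou1_arg.
Qed.

(** Moving the base point from x to y is the same as translating the noise by h, to which
    [cameron_martin] applies. *)
Lemma ou1_shift w s G x y h : w * y = w * x + s * h -> unitf 0 G ->
  ((ou1 w s G y)%:E =
   \int[gam]_z (G (w * x + s * z)%R * expR (h * z - h ^+ 2 / 2))%:E)%E.
Proof.
move=> hE G01; rewrite ou1E//.
have mG : measurable_fun setT (fun z : R => (G (w * x + s * z))%:E).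
  by apply/measurable_EFinP; apply: measurable_ou1_arg; case: G01.
have := @cameron_martin R h _ mG => <-.
  by apply: eq_integral => z _; rewrite hE mulrDr addrAC addrA.
by move=> z; rewrite lee_fin; case: G01 => _ /(_ (w * x + s * z)%R)/andP[].
Qed.

Lemma normal_integral_expR (c h : R) :
  (\int[gam]_z (expR (c * (h * z - h ^+ 2 / 2)))%:E =
   (expR ((c ^+ 2 - c) * h ^+ 2 / 2))%:E)%E.
Proof.
transitivity (\int[gam]_z ((expR (- c * h ^+ 2 / 2))%:E * (expR ((c * h) * z))%:E))%E.
  by apply: eq_integral => z _; rewrite -EFinM -expRD; congr (expR _)%:E; field.
rewrite ge0_integralZl_EFin ?expR_ge0//; last first.
  by apply/measurable_EFinP; apply: measurableT_comp => //; exact: measurable_funM.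
by rewrite normal_mgf -EFinM -expRD; congr (expR _)%:E; field.
Qed.

(* Wang's dimension-free Harnack inequality. *)
Lemma harnack w s G x y (b : nat) : s != 0 -> unitf 0 G -> (0 < b)%N ->
  ou1 w s G y ^+ b.+1 <= ou1 w s (fun z => G z ^+ b.+1) x *
    expR (b.+1%:R * (w * (y - x) / s) ^+ 2 / (2 * b%:R)).
Proof.
move=> s0 G01 b0; set h := w * (y - x) / s.
have [mG G01'] := G01.
have Gp : unitf 0 (fun z => G z ^+ b.+1).
  split; first exact: measurable_funX.
  by move=> z; have /andP[g0 g1] := G01' z; rewrite exprn_ge0//= exprn_ile1.
have b0' : b%:R != 0 :> R by rewrite pnatr_eq0 -lt0n.
(* The exponent conjugate to b + 1. Since b (q^2 - q) = (b + 1) / b, the q-th moment of the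
   Cameron-Martin density gives the stated exponential. *)
pose q : R := b.+1%:R / b%:R.
have -> : expR (b.+1%:R * h ^+ 2 / (2 * b%:R)) = expR ((q ^+ 2 - q) * h ^+ 2 / 2) ^+ b.
  rewrite -expRM_natl; congr expR; rewrite /q -(natr1 b).
  by move: b0' => /[dup] ? ?; field.
apply: (@hoelder_young R _ _ gam b (fun z => G (w * x + s * z) ^+ b.+1)
  (fun z => G (w * x + s * z) * expR (h * z - h ^+ 2 / 2))
  (fun z => expR (q * (h * z - h ^+ 2 / 2)))).
- by apply: measurable_funX; exact: measurable_ou1_arg.
- by apply: measurable_funM; [exact: measurable_ou1_arg|exact: measurable_expR_affine].
- apply: measurableT_comp => //; apply: measurable_funM => //.
  by apply: measurable_funD => //; exact: measurable_funM.
- by move=> z; rewrite exprn_ge0//; case/andP: (G01' (w * x + s * z)).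
- by move=> z; rewrite mulr_ge0 ?expR_ge0//; case/andP: (G01' (w * x + s * z)).
- by move=> z; exact: expR_ge0.
- move=> z l l0; set E := h * z - h ^+ 2 / 2.
  have /andP[g0 _] := G01' (w * x + s * z).
  have := young_exp b g0 (mulr_ge0 l0 (expR_ge0 (E / b%:R))).
  rewrite !exprMn -!expRM_natl.
  have -> : b%:R * (E / b%:R) = E by field.
  have -> : b.+1%:R * (E / b%:R) = q * E by rewrite /q; field.
  by rewrite (mulrCA (G _)) !mulrA.
- by case/andP: (ou1_bounds w s y (lexx 0) G01).
- exact: expR_gt0.
- have hE : w * y = w * x + s * h by rewrite /h (mulrC s) divfK//; ring.
  by rewrite -(ou1_shift hE).
- exact: normal_integral_expR.
- by rewrite ou1E.
Qed.

(** [G] is only measurable. The shift therefore takes x out of [G] and into the exponential weight,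
    where dominated convergence applies. *)
Lemma ou1_continuous w s G : s != 0 -> unitf 0 G -> continuous (ou1 w s G).
Proof.
move=> s0 G01 x0; have [mG G01'] := G01.
pose k := w / s.
pose f (x z : R) := G (s * z) * expR (k * x * z - (k * x) ^+ 2 / 2).
have mf x : measurable_fun setT (f x).
  apply: measurable_funM; last exact: measurable_expR_affine.
  by apply: measurableT_comp => //; exact: measurable_funM.
have f0 x z : 0 <= f x z.
  by rewrite mulr_ge0 ?expR_ge0//; case/andP: (G01' (s * z)).
have fE x : ((ou1 w s G x)%:E = \int[gam]_z (f x z)%:E)%E.
  have hE : w * x = w * 0 + s * (k * x) by rewrite mulr0 add0r mulrA /k (mulrC s) divfK.
  rewrite (ou1_shift hE)//; apply: eq_integral => z _.
  by rewrite mulr0 add0r.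
have -> : ou1 w s G = fun x => \int[gam]_z f x z.
  by apply/funext => x; rewrite /Rintegral -fE.
(* A bound for |k x| on the unit neighbourhood of x0; expR (c |z|) is then dominated by the sum of
   the two integrable exponentials. *)
pose c := `|k| * (`|x0| + 1).
have int_exp (a : R) : gam.-integrable setT (fun z : R => (expR (a * z))%:E).
  apply/integrableP; split.
    by apply/measurable_EFinP; apply: measurableT_comp => //; exact: measurable_funM.
  under eq_integral do rewrite abse_EFin ger0_norm ?expR_ge0//.
  by rewrite normal_mgf ltry.
apply: (@continuity_under_integral R _ _ gam f setT measurableT (x0 - 1) (x0 + 1) _ _
   (fun z => expR (c * z) + expR ((- c) * z))).
- move=> x _; apply/integrableP; split; first by apply/measurable_EFinP; exact: mf.
  under eq_integral do rewrite abse_EFin ger0_norm ?f0//.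
  by rewrite -fE ltry.
- apply: aeW => z _ x _.
  rewrite /f; apply: cvgM; first exact: cvg_cst.
  apply: (cvg_comp _ expR); last exact: continuous_expR.
  apply: cvgB; first by apply: cvgMl => //; apply: cvgMr => //; exact: cvg_id.
  apply: cvgMl => //; apply: (cvg_comp (fun x => k * x) (fun x => x ^+ 2)); last exact: exprn_continuous.
  by apply: cvgMr; exact: cvg_id.
- exact: (integrableD measurableT (int_exp c) (int_exp (- c))).
- move=> x /=; rewrite in_itv/= => /andP[x1 x2]; apply: aeW => z _.
  rewrite ger0_norm ?f0//.
  apply: (@le_trans _ _ (expR (k * x * z))).
    rewrite /f -[leRHS]mul1r ler_pM ?expR_ge0//; first by case/andP: (G01' (s * z)).
      by case/andP: (G01' (s * z)).
    by rewrite ler_expR gerBl divr_ge0 ?sqr_ge0.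
  have kx : `|k * x| <= c.
    rewrite normrM ler_wpM2l//.
    have -> : x = x0 + (x - x0) by ring.
    apply: le_trans (ler_normD _ _) _; rewrite lerD2l.
    by rewrite ler_norml; apply/andP; split; lra.
  have h : k * x * z <= c * `|z|.
    by apply: le_trans (ler_norm _) _; rewrite normrM ler_wpM2r.
  rewrite -ler_expR in h; apply: le_trans h _.
  case: (leP 0 z) => z0.
    by rewrite ler_wpDr ?expR_ge0// ger0_norm.
  by rewrite ler_wpDl ?expR_ge0// ltr0_norm// mulrN mulNr.
- by rewrite inE/= in_itv/=; apply/andP; split; lra.
Qed.

(** Stationarity, as a case of reversibility: after the exchange the integrand no longer sees the
    noise. *)
Lemma ou1_mean w s G : 0 < s -> w ^+ 2 + s ^+ 2 = 1 -> unitf 0 G ->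
  (\int[gam]_x (ou1 w s G x)%:E = \int[gam]_x (G x)%:E)%E.
Proof.
move=> s0 ws [mG G01].
under eq_integral do rewrite ou1E//.
rewrite (@ou_exchange1 R w s (fun p => (G p.2)%:E))//=.
- apply: eq_integral => x _; rewrite integral_cst//= probability_setT mule1//.
- by apply/measurable_EFinP; exact: measurableT_comp.
- by move=> p; rewrite lee_fin; case/andP: (G01 p.2).
Qed.

(* Borell's reverse hypercontractivity on the line: with Q = ou1 (G^(b+1)) and
   U = Q^(-1/(b+1)), [maurey] gives int U int G <= 1, and the reverse Hoelder
   inequality bounds int F^(b+2) Q = int F^(b+2) U^-(b+1) from below. *)
Lemma reverse_hypercontractivity1 w s (e : R) (b : nat) F G :
  0 < s -> w ^+ 2 + s ^+ 2 = 1 -> (0 < b)%N -> 2 * w ^+ 2 <= s ^+ 2 * b%:R ->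
  0 < e -> unitf 0 F -> unitf e G ->
  (((\int[gam]_x F x)%R ^+ b.+2 * (\int[gam]_x G x)%R ^+ b.+1)%:E <=
   \int[gam]_x \int[gam]_z (F x ^+ b.+2 * G (w * x + s * z)%R ^+ b.+1)%:E)%E.
Proof.
move=> s0 ws b0 wsb e0 F01 Ge1.
have [mF F01'] := F01; have [mG Ge1'] := Ge1.
have sn0 : s != 0 by rewrite gt_eqF.
have e1 : e <= 1 by have /andP[/le_trans h /h] := Ge1' 0.
have G01 : unitf 0 G by split => // x; have /andP[/(le_trans (ltW e0))-> ->] := Ge1' x.
have Gp : unitf (e ^+ b.+1) (fun z => G z ^+ b.+1).
  split; first exact: measurable_funX.
  move=> z; have /andP[g0 g1] := Ge1' z.
  have gz : 0 <= G z := le_trans (ltW e0) g0.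
  by rewrite exprn_ile1// andbT ler_pXn2r// nnegrE ltW.
have ep : 0 < e ^+ b.+1 by rewrite exprn_gt0.
have Gp0 : unitf 0 (fun z => G z ^+ b.+1).
  by split; [case: Gp|move=> x; have [_ /(_ x)/andP[/(le_trans (ltW ep))-> ->]] := Gp].
set Q := ou1 w s (fun z => G z ^+ b.+1).
have Qe1 x : e ^+ b.+1 <= Q x <= 1 by apply: ou1_bounds => //; exact: ltW.
have Q0 x : 0 < Q x by have /andP[/(lt_le_trans ep)] := Qe1 x.
have cQ : continuous Q by exact: ou1_continuous.
pose U x := expR (- ln (Q x) / b.+1%:R).
have U0 x : 0 < U x by exact: expR_gt0.
have bn0 : b.+1%:R != 0 :> R by rewrite pnatr_eq0.
have UQ x : U x ^+ b.+1 * Q x = 1.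
  rewrite /U -expRM_natl (mulrC b.+1%:R) divfK//.
  by rewrite expRN lnK ?posrE// mulVf// gt_eqF.
have cU : continuous U.
  move=> x; apply: (cvg_comp _ expR); last exact: continuous_expR.
  apply: cvgMl; apply: cvgN; apply: (cvg_comp Q (@ln R)); first exact: cQ.
  exact: continuous_ln.
have mU : measurable_fun setT U by exact: continuous_measurable_fun.
pose M : R := 1 + expR (- ln (e ^+ b.+1) / b.+1%:R).
have UM x : U x <= M.
  rewrite /M ler_wpDl// ler_expR ler_wpM2r// lerN2 ler_ln ?posrE//.
  by case/andP: (Qe1 x).
have U1 x : 1 <= U x.
  rewrite -expR0 ler_expR divr_ge0// oppr_ge0 ln_le0//.
  by case/andP: (Qe1 x).
have V01 x := ou1_bounds w s x (ltW e0) Ge1.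
(* In the power b + 1, [harnack] and U^(b+1) Q = 1 leave the exponent w^2 (x - y)^2 / (2 b s^2) per
   factor; the hypothesis [wsb] says exactly that this is at most the (x - y)^2 / 4 allowed by
   [maurey]. *)
have UV x y : U x * ou1 w s G y <= expR ((x - y) ^+ 2 / 4).
  have V0 : 0 <= ou1 w s G y by case/andP: (V01 y) => /(le_trans (ltW e0)).
  rewrite -(@ler_pXn2r _ b.+1)// ?nnegrE ?expR_ge0 ?mulr_ge0 ?(ltW (U0 x))//.
  rewrite exprMn.
  have := @harnack w s G x y b sn0 G01 b0; rewrite -/(Q x) => hk.
  apply: le_trans (ler_wpM2l (exprn_ge0 _ (ltW (U0 x))) hk) _.
  rewrite mulrA UQ mul1r -expRM_natl ler_expR -mulrA ler_wpM2l//.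
  have b0' : 0 < b%:R :> R by rewrite ltr0n.
  rewrite ler_pdivrMr ?mulr_gt0// !exprMn exprVn.
  rewrite -(ler_pM2r (exprn_gt0 2 s0)) mulfVK ?expf_neq0//.
  have : 0 <= (s ^+ 2 * b%:R - 2 * w ^+ 2) * (x - y) ^+ 2 by rewrite mulr_ge0 ?sqr_ge0// subr_ge0.
  by nra.
have M1 : 1 <= M by rewrite lerDl expR_ge0.
have := @maurey R U (ou1 w s G) M cU (ou1_continuous sn0 G01) U0 _ UM _ UV.
rewrite ou1_mean// -(unitf_integral gam mG G01.2).
set IG := (\int[gam]_x G x)%R.
have iU : (\int[gam]_x U x)%R%:E = (\int[gam]_x (U x)%:E)%E.
  rewrite /Rintegral fineK//; apply: integrable_fin_num => //.
  apply: (@le_integrable _ _ _ gam _ measurableT _ (cst M%:E)) => //.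
  - exact/measurable_EFinP.
  - by move=> x _ /=; rewrite lee_fin !ger0_norm// ?(ltW (U0 x))// (le_trans ler01 M1).
  - exact: finite_measure_integrable_cst.
rewrite -iU; set IU := (\int[gam]_x U x)%R => mau.
have {}mau : IU * IG <= 1.
  rewrite -lee_fin EFinM; apply: mau => x.
  - by case/andP: (V01 x) => /(lt_le_trans e0).
  - by apply: le_trans M1; case/andP: (V01 x).
have IU1 : 1 <= IU.
  rewrite -lee_fin iU -(integral_prob_cst gam 1).
  apply: ge0_le_integral => //; [exact/measurable_EFinP|].
  by move=> x _; rewrite lee_fin.
have FQ01 x : 0 <= F x ^+ b.+2 * Q x <= 1.
  have /andP[f0 f1] := F01' x; have /andP[_ q1] := Qe1 x.
  by rewrite mulr_ge0 ?exprn_ge0 ?(ltW (Q0 x))//= mulr_ile1// ?exprn_ge0 ?exprn_ile1 ?(ltW (Q0 x)).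
have mQ : measurable_fun setT Q by exact: continuous_measurable_fun.
have mFQ : measurable_fun setT (fun x => F x ^+ b.+2 * Q x).
  by apply: measurable_funM => //; exact: measurable_funX.
have H := @hoelder_young R _ _ gam b.+1 (fun x => F x ^+ b.+2 * Q x) F U
  (\int[gam]_x F x)%R IU (\int[gam]_x (F x ^+ b.+2 * Q x))%R.
have {}H : (\int[gam]_x F x)%R ^+ b.+2 <= (\int[gam]_x (F x ^+ b.+2 * Q x))%R * IU ^+ b.+1.
  apply: H => //.
  - by move=> x; case/andP: (FQ01 x).
  - by move=> x; case/andP: (F01' x).
  - by move=> x; exact: ltW.
  (* Multiplied by U^(b+1), which cancels Q, the claim is Young's inequality for F x and l U x. *)
  - move=> x l l0; rewrite -(ler_pM2r (exprn_gt0 b.+1 (U0 x))).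
    have /andP[f0 _] := F01' x.
    have := young_exp b.+1 f0 (mulr_ge0 l0 (ltW (U0 x))).
    rewrite !exprMn (exprSr (U x) b.+1) => yg.
    have UQ1 : F x ^+ b.+2 * Q x * U x ^+ b.+1 = F x ^+ b.+2.
      by rewrite -mulrA (mulrC (Q x)) UQ mulr1.
    move: (b.+2%:R) (b.+1%:R) yg UQ1 => n2 n1 yg UQ1.
    by rewrite mulrDl UQ1; move: yg; rewrite !mulrA (mulrAC _ (F x)) (mulrAC _ _ (U x)).
  - by case/andP: (Rintegral_unit gam mF (lexx 0) F01').
  - exact: lt_le_trans ltr01 IU1.
  - by rewrite unitf_integral.
  - by rewrite -unitf_integral.
have -> : (\int[gam]_x \int[gam]_z (F x ^+ b.+2 * G (w * x + s * z)%R ^+ b.+1)%:E =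
    (\int[gam]_x (F x ^+ b.+2 * Q x))%R%:E)%E.
  rewrite unitf_integral//; apply: eq_integral => x _.
  under eq_integral do rewrite EFinM.
  rewrite ge0_integralZl_EFin//; last 3 first.
  - by move=> z _; rewrite lee_fin; case: Gp0 => _ /(_ (w * x + s * z))/andP[].
  - apply/measurable_EFinP; case: Gp0 => mGp _; exact: (measurable_ou1_arg w s x mGp).
  - by rewrite exprn_ge0//; case/andP: (F01' x).
  by rewrite [RHS]EFinM /Q ou1E.
rewrite lee_fin; set C := (\int[gam]_x (F x ^+ _ * _))%R in H *.
have C0 : 0 <= C by case/andP: (Rintegral_unit gam mFQ (lexx 0) FQ01).
have IG0 : 0 <= IG by case/andP: (Rintegral_unit gam mG (ltW e0) Ge1') => /(le_trans (ltW e0)).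
(* The factor (IU IG)^(b+1) that appears is at most 1 by [mau]. *)
apply: le_trans (ler_wpM2r (exprn_ge0 b.+1 IG0) H) _.
rewrite -mulrA -exprMn -[leRHS]mulr1 ler_wpM2l// exprn_ile1//.
by rewrite mulr_ge0// (le_trans ler01 IU1).
Qed.

End ou1.

(** * Gaussian vectors *)

Section gaussian_vector.
Variable R : realType.

Section rV_cons.
Variable d : nat.
Implicit Types (p q : R * 'rV[R]_d).

Lemma rV_cons0 p : rV_cons p ord0 ord0 = p.1.
Proof.
have E : (ord0 : 'I_d.+1) = (lshift d (ord0 : 'I_1)) by exact/val_inj.
apply: etrans (congr1 (rV_cons p ord0) E) _.
by apply: (etrans (row_mxEl _ _ _ _)); rewrite mxE.
Qed.

Lemma rV_consS p i : rV_cons p ord0 (lift ord0 i) = p.2 ord0 i.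
Proof.
have E : lift ord0 i = rshift 1 i :> 'I_(1 + d) by exact/val_inj.
by apply: etrans (congr1 (rV_cons p ord0) E) _; exact: row_mxEr.
Qed.

Lemma rV_consP (u : 'rV[R]_d.+1) p :
  u ord0 ord0 = p.1 -> (forall i, u ord0 (lift ord0 i) = p.2 ord0 i) -> u = rV_cons p.
Proof.
move=> u0 uS; apply/rowP => i; case: (unliftP ord0 i) => [j ->|->].
  by rewrite uS [RHS]rV_consS.
by rewrite u0 [RHS]rV_cons0.
Qed.

Lemma rV_cons_comb (w s : R) p q :
  w *: rV_cons p + s *: rV_cons q = rV_cons (w * p.1 + s * q.1, w *: p.2 + s *: q.2).
Proof.
apply: rV_consP => [|i] /=; first by rewrite mxE; congr (_ + _); rewrite mxE rV_cons0.
by rewrite [LHS]mxE [RHS]mxE; congr (_ + _); rewrite [LHS]mxE [RHS]mxE rV_consS.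
Qed.

Lemma rV_consN p : - rV_cons p = rV_cons (- p.1, - p.2).
Proof.
apply: rV_consP => [|i] /=; first by rewrite mxE rV_cons0.
by rewrite [LHS]mxE [RHS]mxE rV_consS.
Qed.

End rV_cons.

Lemma measurable_lincomb d d0 (T : measurableType d0) (w s : R) (f g : T -> 'rV[R]_d) :
  measurable_fun setT f -> measurable_fun setT g ->
  measurable_fun setT (fun x => w *: f x + s *: g x).
Proof.
move=> mf mg; apply: measurable_rVP => i; under eq_fun do rewrite !mxE.
by apply: measurable_funD; apply: measurable_funM => //;
  apply: (measurableT_comp (measurable_coord i)).
Qed.

Lemma measurable_rVN d : measurable_fun [set: 'rV[R]_d] -%R.
Proof.
apply: measurable_rVP => i; under eq_fun do rewrite !mxE.
by apply: measurableT_comp => //; exact: measurable_coord.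
Qed.

Lemma measurable_cons d d0 (T : measurableType d0) (f : T -> R) (g : T -> 'rV[R]_d) :
  measurable_fun setT f -> measurable_fun setT g ->
  measurable_fun setT (fun t => rV_cons (f t, g t)).
Proof.
move=> mf mg; apply: (@measurableT_comp _ _ _ _ _ _ (@rV_cons R d)).
  exact: rV_cons_measurable.
exact: measurable_fun_pair.
Qed.

Local Open Scope ereal_scope.

Lemma integral_gaussian0 (f : 'rV[R]_0 -> \bar R) : measurable_fun setT f ->
  \int[gaussian R 0]_u f u = f 0%R.
Proof. by move=> mf; rewrite /= integral_dirac// diracT mul1e. Qed.

Lemma integral_gaussianS d (f : 'rV[R]_d.+1 -> \bar R) :
  measurable_fun setT f -> (forall u, 0 <= f u) ->
  \int[gaussian R d.+1]_u f u =
  \int[gauss1 R]_x \int[gaussian R d]_v f (rV_cons (x, v)).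
Proof.
move=> mf f0.
have mfc : measurable_fun setT (f \o @rV_cons R d).
  by apply: measurableT_comp => //; exact: rV_cons_measurable.
rewrite ge0_integral_distribution//.
by apply: (@fubini_tonelli1 _ _ _ _ R (gauss1 R) (gaussian R d) _ mfc) => p; exact: f0.
Qed.

Lemma measurable_integral_gaussian d d0 (T : measurableType d0)
    (f : T * 'rV[R]_d -> \bar R) :
  measurable_fun setT f -> (forall u, 0 <= f u) ->
  measurable_fun setT (fun x => \int[gaussian R d]_v f (x, v)).
Proof.
by move=> mf f0; exact: (measurable_fun_fubini_tonelli_F (m2 := gaussian R d) _ mf).
Qed.

(** Both first coordinates are brought outside, so that a statement on the line can act on the outer
    pair of integrals and an induction hypothesis on the inner pair. *)
Lemma integral_gaussianSS d (k : 'rV[R]_d.+1 * 'rV[R]_d.+1 -> \bar R) :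
  measurable_fun setT k -> (forall u, 0 <= k u) ->
  \int[gaussian R d.+1]_u \int[gaussian R d.+1]_g k (u, g) =
  \int[gauss1 R]_x \int[gauss1 R]_z \int[gaussian R d]_v \int[gaussian R d]_h
    k (rV_cons (x, v), rV_cons (z, h)).
Proof.
move=> mk k0; rewrite integral_gaussianS; last 2 first.
- exact: (measurable_integral_gaussian mk k0).
- by move=> u; exact: integral_ge0.
apply: eq_integral => x _.
transitivity (\int[gaussian R d]_v \int[gauss1 R]_z \int[gaussian R d]_h
    k (rV_cons (x, v), rV_cons (z, h))).
  apply: eq_integral => v _; rewrite integral_gaussianS//.
  exact: (measurableT_comp mk (measurable_pair1 _)).
apply: (fubini_tonelli (m1 := gaussian R d) (m2 := gauss1 R)
  (fun p => \int[gaussian R d]_h k (rV_cons (x, p.1), rV_cons (p.2, h)))).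
- apply: (@measurable_integral_gaussian d _ ('rV[R]_d * measurableTypeR R)%type
    (fun q => k (rV_cons (x, q.1.1), rV_cons (q.1.2, q.2)))) => //.
  apply: (measurableT_comp mk); apply: measurable_fun_pair; apply: measurable_cons => //.
  + exact: measurableT_comp.
  + exact: (measurableT_comp (f := snd)).
- by move=> p; exact: integral_ge0.
Qed.

Lemma integral_gaussianN d (f : 'rV[R]_d -> \bar R) :
  measurable_fun setT f -> (forall u, 0 <= f u) ->
  \int[gaussian R d]_u f (- u)%R = \int[gaussian R d]_u f u.
Proof.
elim: d f => [|d IH] f mf f0.
  rewrite !integral_gaussian0 ?oppr0//.
  by apply: measurableT_comp => //; exact: measurable_rVN.
rewrite integral_gaussianS//; last first.
  by apply: measurableT_comp => //; exact: measurable_rVN.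
rewrite [RHS](integral_gaussianS mf f0).
have mfc : measurable_fun setT (f \o @rV_cons R d).
  by apply: measurableT_comp => //; exact: rV_cons_measurable.
transitivity (\int[gauss1 R]_x \int[gaussian R d]_v f (rV_cons ((- x)%R, v))).
  apply: eq_integral => x _.
  under eq_integral do rewrite rV_consN.
  rewrite (IH (fun v => f (rV_cons ((- x)%R, v))))//.
  exact: (measurableT_comp mfc (measurable_pair1 _)).
apply: (@ge0_integral_normalN R (fun x => \int[gaussian R d]_v f (rV_cons (x, v)))).
- by apply: (measurable_integral_gaussian mfc) => p; exact: f0.
- by move=> x; exact: integral_ge0.
Qed.

Lemma gaussian_mgf d (v : 'rV[R]_d) :
  \int[gaussian R d]_u (expR (dot v u))%:E = (expR (sqnorm v / 2))%:E.
Proof.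
elim: d v => [|d IH] v.
  rewrite integral_gaussian0; last first.
    by apply/measurable_EFinP; apply: measurableT_comp => //; exact: dot_measurable.
  by rewrite /sqnorm /dot !big_ord0 mul0r.
rewrite integral_gaussianS; last 2 first.
- by apply/measurable_EFinP; apply: measurableT_comp => //; exact: dot_measurable.
- by move=> u; rewrite lee_fin expR_ge0.
pose v' : 'rV[R]_d := \row_i v ord0 (lift ord0 i).
have dotE x (u : 'rV[R]_d) : dot v (rV_cons (x, u)) = (v ord0 ord0 * x + dot v' u)%R.
  rewrite /dot big_ord_recl rV_cons0; congr (_ + _)%R.
  by apply: eq_bigr => i _; rewrite rV_consS mxE.
transitivity (\int[gauss1 R]_x ((expR (sqnorm v' / 2))%:E * (expR (v ord0 ord0 * x))%:E)).
  apply: eq_integral => x _; under eq_integral do rewrite dotE expRD EFinM.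
  rewrite ge0_integralZl_EFin ?expR_ge0 ?IH 1?muleC//.
  by apply/measurable_EFinP; apply: measurableT_comp => //; exact: dot_measurable.
rewrite ge0_integralZl_EFin ?expR_ge0//; last first.
  by apply/measurable_EFinP; apply: measurableT_comp => //; exact: measurable_funM.
rewrite normal_mgf -EFinM -expRD; congr (expR _)%:E.
rewrite /sqnorm /dot big_ord_recl addrC mulrDl expr2; congr (_ / _ + _ / _)%R.
by apply: eq_bigr => i _; rewrite mxE.
Qed.

(** Coordinatewise: the induction hypothesis exchanges the tails with the heads frozen, and
    [ou_exchange1] then exchanges the heads in [Psi]. *)
Lemma ou_exchange d (w s : R) (f : 'rV[R]_d * 'rV[R]_d -> \bar R) :
  (0 < s)%R -> (w ^+ 2 + s ^+ 2 = 1)%R ->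
  measurable_fun setT f -> (forall x, 0 <= f x) ->
  \int[gaussian R d]_u \int[gaussian R d]_g f (u, w *: u + s *: g)%R =
  \int[gaussian R d]_u \int[gaussian R d]_g f (w *: u + s *: g, u)%R.
Proof.
move=> s0 ws; elim: d f => [|d IH] f mf f0.
  have rV0 (v : 'rV[R]_0) : v = 0%R by apply/rowP => -[].
  by apply: eq_integral => u _; apply: eq_integral => g _; rewrite (rV0 u) (rV0 (_ + _)%R).
have mou (d' : nat) : measurable_fun setT (fun p : 'rV[R]_d' * 'rV[R]_d' => (w *: p.1 + s *: p.2)%R).
  exact: measurable_lincomb.
have mf1 := measurableT_comp mf (measurable_fun_pair measurable_fst (mou d.+1)).
have mf2 := measurableT_comp mf (measurable_fun_pair (mou d.+1) measurable_fst).
apply: etrans (integral_gaussianSS mf1 (fun u => f0 _)) _.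
apply: etrans (esym (integral_gaussianSS mf2 (fun u => f0 _))).
pose k (x y : R) (v v' : 'rV[R]_d) := f (rV_cons (x, v), rV_cons (y, v')).
pose Psi (p : R * R) := \int[gaussian R d]_v \int[gaussian R d]_h
  k p.1 p.2 (w *: v + s *: h)%R v.
transitivity (\int[gauss1 R]_x \int[gauss1 R]_z Psi (x, w * x + s * z)%R).
  apply: eq_integral => x _; apply: eq_integral => z _.
  transitivity (\int[gaussian R d]_v \int[gaussian R d]_h
      k x (w * x + s * z)%R v (w *: v + s *: h)%R).
    by apply: eq_integral => v _; apply: eq_integral => h _; rewrite /= rV_cons_comb.
  apply: (IH (fun p => k x (w * x + s * z)%R p.1 p.2)) => //; last by move=> p; exact: f0.
  by apply: (measurableT_comp mf); apply: measurable_fun_pair; apply: measurable_cons.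
apply: etrans (@ou_exchange1 R w s Psi s0 ws _ _) _.
- apply: (@measurable_integral_gaussian d _ (R * R)%type (fun q => \int[gaussian R d]_h
    f (rV_cons (q.1.1, w *: q.2 + s *: h)%R, rV_cons (q.1.2, q.2)))); last first.
    by move=> q; exact: integral_ge0.
  apply: (@measurable_integral_gaussian d _ (R * R * 'rV[R]_d)%type (fun q =>
    f (rV_cons (q.1.1.1, w *: q.1.2 + s *: q.2)%R, rV_cons (q.1.1.2, q.1.2)))) => //.
  apply: (measurableT_comp mf); apply: measurable_fun_pair; apply: measurable_cons.
  + exact: (measurableT_comp measurable_fst (measurableT_comp measurable_fst measurable_fst)).
  + apply: measurable_lincomb; last exact: measurable_snd.
    exact: (measurableT_comp measurable_snd measurable_fst).
  + exact: (measurableT_comp measurable_snd (measurableT_comp measurable_fst measurable_fst)).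
  + exact: (measurableT_comp measurable_snd measurable_fst).
- by move=> p; apply: integral_ge0 => v _; apply: integral_ge0 => h _; exact: f0.
- apply: eq_integral => x _; apply: eq_integral => z _.
  by apply: eq_integral => v _; apply: eq_integral => h _; rewrite /= rV_cons_comb.
Qed.

Section reverse_hypercontractivity.
Variables (w s : R) (b : nat).
Hypotheses (s0 : (0 < s)%R) (ws : (w ^+ 2 + s ^+ 2 = 1)%R) (b0 : (0 < b)%N).
Hypothesis wsb : (2 * w ^+ 2 <= s ^+ 2 * b%:R)%R.

(** Slices and their averages keep the same bounds, so tensorization never loses the constant e. *)
Lemma unitf_section d (e : R) (F : 'rV[R]_d.+1 -> R) : (0 <= e)%R -> unitf e F ->
  (forall x, unitf e (fun v => F (rV_cons (x, v)))) /\
  unitf e (fun x => \int[gaussian R d]_v F (rV_cons (x, v)))%R.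
Proof.
move=> e0 [mF Fe1].
have mFc : measurable_fun setT (F \o @rV_cons R d).
  by apply: measurableT_comp => //; exact: rV_cons_measurable.
have uF x : unitf e (fun v => F (rV_cons (x, v))).
  by split => //; exact: (measurableT_comp mFc (measurable_pair1 _)).
split => //; split.
  apply/measurable_EFinP.
  rewrite (_ : _ \o _ = fun x => \int[gaussian R d]_v (F (rV_cons (x, v)))%:E).
    apply: (@measurable_integral_gaussian d _ R (fun p => (F (rV_cons p))%:E)).
      exact/measurable_EFinP.
    by move=> u; rewrite lee_fin (le_trans e0)//; case/andP: (Fe1 (rV_cons u)).
  apply/funext => x /=; rewrite unitf_integral//; first by case: (uF x).
  by move=> v; have /andP[/(le_trans e0)-> ->] := Fe1 (rV_cons (x, v)).
by move=> x; apply: Rintegral_unit => //; case: (uF x).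
Qed.

Lemma Rintegral_gaussianS d (F : 'rV[R]_d.+1 -> R) : unitf 0%R F ->
  (\int[gaussian R d.+1]_u F u =
   \int[gauss1 R]_x \int[gaussian R d]_v F (rV_cons (x, v)))%R.
Proof.
move=> uF; have [uFx uF1] := unitf_section (lexx 0%R) uF.
case: (uF) => mF F01; apply: EFin_inj; rewrite !unitf_integral//; try by case: uF1.
rewrite integral_gaussianS//; last 2 first.
- exact/measurable_EFinP.
- by move=> u; rewrite lee_fin; case/andP: (F01 u).
apply: eq_integral => x _; rewrite unitf_integral//; by case: (uFx x).
Qed.

(** Tensorization: the inequality on the line is applied to the averages over slices, then the
    induction hypothesis to the slices at x and at w x + s z. *)
Lemma reverse_hypercontractivity d (e : R) (F G : 'rV[R]_d -> R) :
  (0 < e)%R -> unitf 0%R F -> unitf e G ->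
  ((\int[gaussian R d]_u F u)%R ^+ b.+2 * (\int[gaussian R d]_u G u)%R ^+ b.+1)%:E <=
   \int[gaussian R d]_u \int[gaussian R d]_g
      (F u ^+ b.+2 * G (w *: u + s *: g)%R ^+ b.+1)%:E.
Proof.
move=> e0; elim: d F G => [|d IH] F G uF uG.
  case: (uF) (uG) => mF F01 [mG Ge1].
  have rV0 (v : 'rV[R]_0) : v = 0%R by apply/rowP => -[].
  have -> : (\int[gaussian R 0]_u F u)%R = F 0%R.
    by rewrite /Rintegral integral_gaussian0//; exact/measurable_EFinP.
  have -> : (\int[gaussian R 0]_u G u)%R = G 0%R.
    by rewrite /Rintegral integral_gaussian0//; exact/measurable_EFinP.
  rewrite (eq_integral (cst (F 0%R ^+ b.+2 * G 0%R ^+ b.+1)%:E)); last first.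
    move=> u _; rewrite (eq_integral (cst (F 0%R ^+ b.+2 * G 0%R ^+ b.+1)%:E)).
      exact: integral_prob_cst.
    by move=> g _; rewrite (rV0 (_ + _)%R) (rV0 u).
  by rewrite integral_prob_cst.
have [uFx uF1] := unitf_section (lexx 0%R) uF.
have [uGx uG1] := unitf_section (ltW e0) uG.
have uG0 : unitf 0%R G.
  by case: uG => mG Ge1; split => // x; have /andP[/(le_trans (ltW e0))-> ->] := Ge1 x.
rewrite (Rintegral_gaussianS uF) (Rintegral_gaussianS uG0).
apply: le_trans (reverse_hypercontractivity1 s0 ws b0 wsb e0 uF1 uG1) _.
have mou (d' : nat) : measurable_fun setT
    (fun p : 'rV[R]_d' * 'rV[R]_d' => (w *: p.1 + s *: p.2)%R).
  exact: measurable_lincomb.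
have mFG (d' : nat) (F' G' : 'rV[R]_d' -> R) : measurable_fun setT F' ->
    measurable_fun setT G' ->
    measurable_fun setT (fun p : 'rV[R]_d' * 'rV[R]_d' =>
      (F' p.1 ^+ b.+2 * G' (w *: p.1 + s *: p.2)%R ^+ b.+1)%:E).
  move=> mF' mG'; apply/measurable_EFinP; apply: measurable_funM; apply: measurable_funX.
    exact: measurableT_comp.
  exact: (measurableT_comp mG' (mou d')).
have FG0 (d' : nat) (F' G' : 'rV[R]_d' -> R) : unitf 0%R F' -> unitf e G' ->
    forall p : 'rV[R]_d' * 'rV[R]_d',
      0 <= (F' p.1 ^+ b.+2 * G' (w *: p.1 + s *: p.2)%R ^+ b.+1)%:E.
  move=> [_ F01] [_ G01] p; rewrite lee_fin mulr_ge0 ?exprn_ge0//.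
    by case/andP: (F01 p.1).
  by rewrite (le_trans (ltW e0))//; case/andP: (G01 (w *: p.1 + s *: p.2)%R).
have mk := mFG _ _ _ uF.1 uG.1; have k0 := FG0 _ _ _ uF uG.
apply: (@eq_ind_r _ _ (fun X => _ <= X) _ _ (integral_gaussianSS mk k0)).
set F1 := (fun x => _) in uF1; set G1 := (fun x => _) in uG1.
pose f1 (p : R * R) := (F1 p.1 ^+ b.+2 * G1 (w * p.1 + s * p.2)%R ^+ b.+1)%:E.
pose f2 (p : R * R) := \int[gaussian R d]_v \int[gaussian R d]_h
  (F (rV_cons (p.1, v)) ^+ b.+2 *
   G (w *: rV_cons (p.1, v) + s *: rV_cons (p.2, h))%R ^+ b.+1)%:E.
have m1 : measurable_fun setT f1.
  apply/measurable_EFinP; apply: measurable_funM; apply: measurable_funX.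
    exact: (measurableT_comp uF1.1 measurable_fst).
  apply: (measurableT_comp uG1.1).
  by apply: measurable_funD; apply: measurable_funM.
have f10 p : 0 <= f1 p.
  rewrite lee_fin mulr_ge0 ?exprn_ge0//; first by case: uF1 => _ /(_ p.1)/andP[].
  by case: uG1 => _ /(_ (w * p.1 + s * p.2)%R)/andP[/(le_trans (ltW e0))].
have m2 : measurable_fun setT f2.
  apply: (@measurable_integral_gaussian d _ (R * R)%type (fun q => \int[gaussian R d]_h
    (F (rV_cons (q.1.1, q.2)) ^+ b.+2 *
     G (w *: rV_cons (q.1.1, q.2) + s *: rV_cons (q.1.2, h))%R ^+ b.+1)%:E)); last first.
    by move=> q; apply: integral_ge0 => h _; exact: (k0 (_, _)).
  apply: (@measurable_integral_gaussian d _ (R * R * 'rV[R]_d)%type (fun q =>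
    (F (rV_cons (q.1.1.1, q.1.2)) ^+ b.+2 *
     G (w *: rV_cons (q.1.1.1, q.1.2) + s *: rV_cons (q.1.1.2, q.2))%R ^+ b.+1)%:E)); last first.
    by move=> q; exact: (k0 (_, _)).
  have m11 := measurableT_comp measurable_fst
    (@measurable_fst _ _ (R * R * 'rV[R]_d)%type 'rV[R]_d).
  have mc1 := measurable_cons (measurableT_comp measurable_fst m11)
    (measurableT_comp measurable_snd measurable_fst).
  have mc2 := measurable_cons (measurableT_comp measurable_snd m11) measurable_snd.
  exact: (measurableT_comp mk (measurable_fun_pair mc1 mc2)).
have f20 p : 0 <= f2 p.
  by apply: integral_ge0 => v _; apply: integral_ge0 => h _; exact: (k0 (_, _)).
apply: ge0_le_integral; first exact: measurableT.
- by move=> x _; apply: integral_ge0 => z _; exact: (f10 (x, z)).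
- exact: (measurable_fun_fubini_tonelli_F (m2 := gauss1 R) _ m1).
- exact: (measurable_fun_fubini_tonelli_F (m2 := gauss1 R) _ m2).
move=> x _; apply: ge0_le_integral; first exact: measurableT.
- by move=> z _; exact: (f10 (x, z)).
- exact: (measurableT_comp m1 (measurable_pair1 x)).
- exact: (measurableT_comp m2 (measurable_pair1 x)).
move=> z _; apply: le_trans (IH _ _ (uFx x) (uGx (w * x + s * z)%R)) _.
rewrite le_eqVlt; apply/orP; left; apply/eqP.
apply: eq_integral => v _; apply: eq_integral => h _ /=.
by rewrite rV_cons_comb.
Qed.

End reverse_hypercontractivity.
End gaussian_vector.

(** * Walks and their adjoints *)

Section gaussian_sets.
Variables (R : realType) (w s : R) (b : nat).
Hypotheses (s0 : 0 < s) (ws : w ^+ 2 + s ^+ 2 = 1) (b0 : (0 < b)%N).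
Hypothesis wsb : 2 * w ^+ 2 <= s ^+ 2 * b%:R.
Local Open Scope ereal_scope.

(** The indicator of [B] vanishes somewhere, so it is replaced by its maximum with a small [e1];
    powers do not change indicators, and the error is at most [e1]. *)
Lemma gaussian_correlated_sets d (A B : set 'rV[R]_d) : measurable A -> measurable B ->
  (fine (gaussian R d A) ^+ b.+2 * fine (gaussian R d B) ^+ b.+1)%R%:E <=
  \int[gaussian R d]_u \int[gaussian R d]_g
     (\1_A u * \1_B (w *: u + s *: g))%R%:E.
Proof.
move=> mA mB; apply/lee_addgt0Pr => e e0.
(* Capped at 1 so that [G] stays below 1 and a power of [e1] is at most [e1]. *)
pose e1 : R := Num.min e 1%R.
have e10 : (0 < e1)%R by rewrite lt_min e0 ltr01.
have e11 : (e1 <= 1)%R by rewrite ge_min lexx orbT.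
pose G (u : 'rV[R]_d) : R := Num.max (\1_B u) e1.
have uA : unitf 0%R (\1_A : 'rV[R]_d -> R).
  by split => // u; rewrite indicE; case: (_ \in _); rewrite ?lexx ?ler01.
have uB : unitf 0%R (\1_B : 'rV[R]_d -> R).
  by split => // u; rewrite indicE; case: (_ \in _); rewrite ?lexx ?ler01.
have uG : unitf e1 G.
  split; first exact: measurable_maxr.
  by move=> u; rewrite le_max lexx orbT /= ge_max e11 andbT; have /andP[] := uB.2 u.
have uG0 : unitf 0%R G.
  by split; [exact: uG.1|move=> u; have /andP[/(le_trans (ltW e10))-> ->] := uG.2 u].
have intA (C : set 'rV[R]_d) : measurable C ->
    (\int[gaussian R d]_u \1_C u)%R = fine (gaussian R d C).
  by move=> mC; rewrite /Rintegral integral_indic// setIT.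
have BG : (fine (gaussian R d B) <= (\int[gaussian R d]_u G u)%R)%R.
  rewrite -intA// -lee_fin !unitf_integral; [|exact: uG.1|exact: uG0.2|exact: uB.1|exact: uB.2].
  apply: ge0_le_integral => //.
  - exact/measurable_EFinP.
  - by apply/measurable_EFinP; exact: uG.1.
  - by move=> u _; rewrite lee_fin le_max lexx.
have := @reverse_hypercontractivity R w s b s0 ws b0 wsb d e1 _ G e10 uA uG.
rewrite intA// => h.
apply: (le_trans _ (le_trans h _)).
  rewrite lee_fin ler_wpM2l ?exprn_ge0 ?fine_ge0//.
  have fB0 : (0 <= fine (gaussian R d B))%R by rewrite fine_ge0.
  by rewrite ler_pXn2r ?nnegrE// (le_trans fB0 BG).
have mou : measurable_fun setT (fun p : 'rV[R]_d * 'rV[R]_d => w *: p.1 + s *: p.2)%R.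
  exact: measurable_lincomb.
have mAB : measurable_fun setT (fun p : 'rV[R]_d * 'rV[R]_d =>
    ((\1_A p.1 : R) * \1_B (w *: p.1 + s *: p.2))%R%:E).
  apply/measurable_EFinP; apply: measurable_funM.
    exact: (measurableT_comp uA.1 measurable_fst).
  exact: (measurableT_comp uB.1 mou).
have AB0 p : 0 <= ((\1_A p.1 : R) * \1_B (w *: p.1 + s *: p.2))%R%:E.
  by rewrite lee_fin mulr_ge0.
have mAG : measurable_fun setT (fun p : 'rV[R]_d * 'rV[R]_d =>
    ((\1_A p.1 : R) ^+ b.+2 * G (w *: p.1 + s *: p.2) ^+ b.+1)%R%:E).
  apply/measurable_EFinP; apply: measurable_funM; apply: measurable_funX.
    exact: (measurableT_comp uA.1 measurable_fst).
  exact: (measurableT_comp uG.1 mou).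
have AG0 p : 0 <= ((\1_A p.1 : R) ^+ b.+2 * G (w *: p.1 + s *: p.2) ^+ b.+1)%R%:E.
  by rewrite lee_fin mulr_ge0 ?exprn_ge0//; have /andP[] := uG0.2 (w *: p.1 + s *: p.2)%R.
have pt (u v : 'rV[R]_d) : ((\1_A u : R) ^+ b.+2 * G v ^+ b.+1 <= \1_A u * \1_B v + e1)%R.
  rewrite /G !indicE; case: (u \in A); last by rewrite exprS !mul0r add0r ltW.
  rewrite expr1n !mul1r; case: (v \in B) => /=.
    by rewrite max_l// expr1n lerDl ltW.
  by rewrite max_r ?(ltW e10)// add0r exprS ler_piMr ?(ltW e10)// exprn_ile1// ltW.
have -> : e%:E = e%:E * 1 by rewrite mule1.
apply: (@le_trans _ _ (\int[gaussian R d]_u (\int[gaussian R d]_g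
    ((\1_A u : R) * \1_B (w *: u + s *: g))%R%:E + e1%:E))).
  apply: ge0_le_integral; first exact: measurableT.
  - by move=> u _; apply: integral_ge0 => g _; exact: (AG0 (u, g)).
  - exact: (measurable_integral_gaussian mAG).
  - apply: emeasurable_funD => //; exact: (measurable_integral_gaussian mAB).
  move=> u _; rewrite -(integral_prob_cst (gaussian R d) e1) -ge0_integralD//.
  - apply: ge0_le_integral; first exact: measurableT.
    + by move=> g _; exact: (AG0 (u, g)).
    + exact: (measurableT_comp mAG (measurable_pair1 u)).
    + by apply: emeasurable_funD => //; exact: (measurableT_comp mAB (measurable_pair1 u)).
    + by move=> g _; rewrite -EFinD lee_fin.
  - exact: (measurableT_comp mAB (measurable_pair1 u)).
  - by move=> g _; rewrite lee_fin ltW.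
rewrite ge0_integralD//.
- by rewrite integral_prob_cst mule1 leeD2l// lee_fin ge_min lexx.
- by move=> u _; apply: integral_ge0 => g _; exact: (AB0 (u, g)).
- exact: (measurable_integral_gaussian mAB).
- by move=> u _; rewrite lee_fin ltW.
Qed.

End gaussian_sets.

Section operators.
Local Open Scope ereal_scope.
Variables (R : realType) (d n : nat) (w s : R).
Variable m : 'I_n -> 'I_n -> 'rV[R]_d -> \bar R.
Hypothesis mm : forall x y, measurable_fun setT (m x y).
Hypothesis m0 : forall x y u, 0 <= m x y u.
Hypothesis mN : forall x y u, m x y (- u)%R = m y x u.
Notation fam := ('I_n -> 'rV[R]_d -> \bar R).
Notation gam := (gaussian R d).
Implicit Types (f g : fam).

Definition nnfam f := (forall x, measurable_fun setT (f x)) /\ forall x u, 0 <= f x u.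

Definition reflect_fam f : fam := fun x u => f x (- u)%R.
Definition ou_fam f : fam := fun x u => \int[gam]_g f x (w *: u + s *: g)%R.
Definition step_fam f : fam := fun x u => \sum_y m x y u * f y u.
(** The index counts Ornstein-Uhlenbeck steps, so [walk_fam k] makes k + 1 matching steps. *)
Fixpoint walk_fam k f : fam :=
  if k is k'.+1 then step_fam (ou_fam (walk_fam k' f)) else step_fam f.
Definition pairing f g := \sum_x \int[gam]_u (f x u * g x u).

Local Notation J := reflect_fam.
Local Notation T := ou_fam.
Local Notation S := step_fam.
Local Notation W := walk_fam.

Lemma nnfam_reflect f : nnfam f -> nnfam (J f).
Proof.
move=> [mf f0]; split => [x|x u]; last exact: f0.
by apply: (measurableT_comp (mf x)); exact: measurable_rVN.
Qed.

Lemma measurable_ou_fam f x : nnfam f -> measurable_fun setT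
  (fun p : 'rV[R]_d * 'rV[R]_d => f x (w *: p.1 + s *: p.2)%R).
Proof. by move=> [mf f0]; apply: (measurableT_comp (mf x)); exact: measurable_lincomb. Qed.

Lemma nnfam_ou f : nnfam f -> nnfam (T f).
Proof.
move=> nf; have [mf f0] := nf; split => [x|x u]; last by apply: integral_ge0 => g _; exact: f0.
by apply: (measurable_integral_gaussian (measurable_ou_fam x nf)) => p; exact: f0.
Qed.

Lemma nnfam_step f : nnfam f -> nnfam (S f).
Proof.
move=> [mf f0]; split => [x|x u].
  by apply: emeasurable_sum => y; exact: emeasurable_funM.
by apply: sume_ge0 => y _; exact: mule_ge0.
Qed.

Lemma nnfam_walk k f : nnfam f -> nnfam (W k f).
Proof. by elim: k => [|k IH] nf; apply: nnfam_step => //; exact/nnfam_ou/IH. Qed.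

Lemma le_ou f g : nnfam f -> nnfam g -> (forall x u, f x u <= g x u) ->
  forall x u, T f x u <= T g x u.
Proof.
move=> nf ng fg x u; apply: ge0_le_integral => //.
- by move=> h _; exact: nf.2.
- exact: (measurableT_comp (measurable_ou_fam x nf) (measurable_pair1 u)).
- exact: (measurableT_comp (measurable_ou_fam x ng) (measurable_pair1 u)).
Qed.

Lemma le_step f g : (forall x u, f x u <= g x u) -> forall x u, S f x u <= S g x u.
Proof. by move=> fg x u; apply: lee_sum => y _; exact: lee_wpmul2l. Qed.

Lemma le_walk k f g : nnfam f -> nnfam g -> (forall x u, f x u <= g x u) ->
  forall x u, W k f x u <= W k g x u.
Proof.
move=> nf ng fg; elim: k => [|k IH]; first exact: le_step.
by apply: le_step; apply: le_ou => //; exact: nnfam_walk.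
Qed.

Lemma reflect_famK f : J (J f) = f.
Proof. by apply/funext => x; apply/funext => u; rewrite /reflect_fam opprK. Qed.

Lemma pairingC f g : pairing f g = pairing g f.
Proof. by apply: eq_bigr => x _; apply: eq_integral => u _; rewrite muleC. Qed.

Lemma le_pairing f g f' g' : nnfam f -> nnfam g -> nnfam f' -> nnfam g' ->
  (forall x u, f x u <= f' x u) -> (forall x u, g x u <= g' x u) ->
  pairing f g <= pairing f' g'.
Proof.
move=> nf ng nf' ng' ff gg; apply: lee_sum => x _; apply: ge0_le_integral => //.
- by move=> u _; rewrite mule_ge0 ?nf.2 ?ng.2.
- by apply: emeasurable_funM; [exact: nf.1|exact: ng.1].
- by apply: emeasurable_funM; [exact: nf'.1|exact: ng'.1].
- by move=> u _; apply: lee_pmul => //; [exact: nf.2|exact: ng.2].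
Qed.

Lemma pairing_reflect f g : nnfam f -> nnfam g -> pairing (J f) (J g) = pairing f g.
Proof.
move=> nf ng; apply: eq_bigr => x _.
apply: (integral_gaussianN (f := fun u => f x u * g x u)).
  by apply: emeasurable_funM; [exact: nf.1|exact: ng.1].
by move=> u; rewrite mule_ge0 ?nf.2 ?ng.2.
Qed.

Lemma ou_reflect f : nnfam f -> T (J f) = J (T f).
Proof.
move=> nf; apply/funext => x; apply/funext => u; rewrite /reflect_fam /ou_fam.
rewrite -[RHS](integral_gaussianN (f := fun h => f x (w *: - u + s *: h)%R)).
- by apply: eq_integral => g _; rewrite opprD !scalerN.
- exact: (measurableT_comp (measurable_ou_fam x nf) (measurable_pair1 (- u)%R)).
- by move=> g; exact: nf.2.
Qed.

Hypotheses (s0 : (0 < s)%R) (ws : (w ^+ 2 + s ^+ 2 = 1)%R).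

Lemma pairing_ou f g : nnfam f -> nnfam g -> pairing f (T g) =
  \sum_x \int[gam]_u \int[gam]_h (f x u * g x (w *: u + s *: h)%R).
Proof.
move=> nf ng; apply: eq_bigr => x _; apply: eq_integral => u _.
rewrite -ge0_integralZl//; [|by move=> h _; exact: ng.2|exact: nf.2].
exact: (measurableT_comp (measurable_ou_fam x ng) (measurable_pair1 u)).
Qed.

Lemma ou_self_adjoint f g : nnfam f -> nnfam g -> pairing (T f) g = pairing f (T g).
Proof.
move=> nf ng; rewrite pairingC !pairing_ou//; apply: eq_bigr => x _.
apply: etrans (ou_exchange (f := fun p => g x p.1 * f x p.2) s0 ws _ _) _.
- apply: emeasurable_funM; first exact: (measurableT_comp (ng.1 x) measurable_fst).
  exact: (measurableT_comp (nf.1 x) measurable_snd).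
- by move=> p; rewrite mule_ge0 ?nf.2 ?ng.2.
- by apply: eq_integral => u _; apply: eq_integral => h _; rewrite muleC.
Qed.

Lemma pairing_step f g : nnfam f -> nnfam g -> pairing f (S g) =
  \sum_x \sum_y \int[gam]_u (f x u * (m x y u * g y u)).
Proof.
move=> nf ng; apply: eq_bigr => x _.
rewrite -ge0_integral_sum//.
- by apply: eq_integral => u _; rewrite ge0_sume_distrr// => y _; rewrite mule_ge0 ?ng.2.
- move=> y; apply: emeasurable_funM; first exact: nf.1.
  by apply: emeasurable_funM => //; exact: ng.1.
- by move=> y u _; rewrite !mule_ge0 ?nf.2 ?ng.2.
Qed.

(** The substitution of - u for u turns [m x y] into [m y x]: up to the reflection J on both sides,
    skew-symmetry makes S self-adjoint. *)
Lemma step_adjoint f g : nnfam f -> nnfam g -> pairing f (S g) = pairing (J g) (S (J f)).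
Proof.
move=> nf ng; rewrite !pairing_step//; try exact: nnfam_reflect.
rewrite exchange_big; apply: eq_bigr => y _; apply: eq_bigr => x _.
rewrite -[LHS](integral_gaussianN (f := fun u => f x u * (m x y u * g y u))).
- by apply: eq_integral => u _; rewrite mN muleA muleC (muleC (f x _)).
- apply: emeasurable_funM; first exact: nf.1.
  by apply: emeasurable_funM => //; exact: ng.1.
- by move=> u; rewrite !mule_ge0 ?nf.2 ?ng.2.
Qed.

Lemma walk_comp k l f : W (k + l).+1 f = W k (T (W l f)).
Proof. by elim: k => [//|k IH]; rewrite addSn [in LHS]/= -/(W (k + l).+1 f) IH. Qed.

(** The word S T S ... T S is a palindrome, T commutes with J, and each letter is self-adjoint up to
    J. *)
Lemma walk_adjoint k f g : nnfam f -> nnfam g ->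
  pairing f (W k g) = pairing (J g) (W k (J f)).
Proof.
elim: k f g => [|k IH] f g nf ng; first exact: step_adjoint.
have nJf := nnfam_reflect nf.
have nSJf := nnfam_step nJf.
rewrite [in LHS]/= step_adjoint//; last exact/nnfam_ou/nnfam_walk.
rewrite -pairing_reflect; [|exact/nnfam_reflect/nnfam_ou/nnfam_walk|exact: nnfam_step].
rewrite reflect_famK ou_self_adjoint; [|exact: nnfam_walk|exact: nnfam_reflect].
rewrite pairingC IH//; last exact/nnfam_ou/nnfam_reflect.
by rewrite ou_reflect// reflect_famK; have := walk_comp k 0 (J f); rewrite addn0 => ->.
Qed.

End operators.

(** * Robustness of walks *)

Section robust.
Local Open Scope ereal_scope.
Variables (R : realType) (d n : nat) (w s : R) (b : nat).
Variable m : 'I_n -> 'I_n -> 'rV[R]_d -> \bar R.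
Hypothesis n0 : (0 < n)%N.
Hypothesis mm : forall x y, measurable_fun setT (m x y).
Hypothesis m0 : forall x y u, 0 <= m x y u.
Hypothesis mN : forall x y u, m x y (- u)%R = m y x u.
Hypothesis m1 : forall x u, \sum_y m x y u <= 1.
Hypotheses (s0 : (0 < s)%R) (ws : (w ^+ 2 + s ^+ 2 = 1)%R) (b0 : (0 < b)%N).
Hypothesis wsb : (2 * w ^+ 2 <= s ^+ 2 * b%:R)%R.
Notation gam := (gaussian R d).
Local Notation J := (@reflect_fam R d n).
Local Notation T := (ou_fam w s).
Local Notation W := (walk_fam w s m).
Implicit Types A G : 'I_n -> set 'rV[R]_d.

Definition avoid A : 'I_n -> 'rV[R]_d -> \bar R := fun x u => (\1_(~` A x) u)%:E.

(* The end point is tested in the reflected direction, so that by skew-symmetry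
   the condition is invariant under reversal of the walk. *)
Definition robust k (beta eta : R) := forall A, (forall x, measurable (A x)) ->
  \sum_x gam (A x) <= (n%:R * beta)%:E ->
  (n%:R * eta)%:E <= pairing (avoid A) (W k (J (avoid A))).

Lemma nnfam_avoid A : (forall x, measurable (A x)) -> nnfam (avoid A).
Proof.
move=> mA; split => [x|x u]; last by rewrite lee_fin.
by apply/measurable_EFinP; apply: measurable_indic; exact: measurableC.
Qed.

Lemma gaussian_indic (B : set 'rV[R]_d) : measurable B ->
  gam B = \int[gam]_u (\1_B u)%:E.
Proof. by move=> mB; rewrite integral_indic// setIT. Qed.

(** Deleting [A] destroys mass at most gam (A x) at starting points, as the out-mass is at most 1,
    and as much at end points, as the in-mass is too by skew-symmetry ([m1']). What remains is delta
    - 2 (delta / 4). *)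
Lemma robust0 (delta : R) :
  (n%:R * delta)%:E <= \sum_x \int[gam]_u (\sum_y m x y u) ->
  robust 0 (delta / 4) (delta / 2).
Proof.
move=> md A mA Abeta.
have nA := nnfam_avoid mA.
have nJA := nnfam_reflect nA.
rewrite pairing_step//.
have mi x y : measurable_fun setT (fun u => avoid A x u * (m x y u * J (avoid A) y u)).
  by apply: emeasurable_funM; [exact: nA.1|apply: emeasurable_funM => //; exact: nJA.1].
have mi0 x y u : 0 <= avoid A x u * (m x y u * J (avoid A) y u).
  by rewrite !mule_ge0 ?nA.2 ?nJA.2.
have mAi x : measurable_fun setT (fun u : 'rV[R]_d => ((\1_(A x) u : R)%:E)).
  by apply/measurable_EFinP; exact: measurable_indic.
have mANi x : measurable_fun setT (fun u : 'rV[R]_d => ((\1_(A x) (- u)%R : R)%:E)).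
  by apply: (measurableT_comp (mAi x)); exact: measurable_rVN.
have m1' y u : \sum_x m x y u <= 1.
  by under eq_bigr do rewrite -mN; exact: m1.
have pt x y u : m x y u <= avoid A x u * (m x y u * J (avoid A) y u) +
    (m x y u * (\1_(A x) u)%:E + m x y u * (\1_(A y) (- u)%R)%:E).
  rewrite /avoid /reflect_fam !indicE !in_setC.
  case: (u \in A x); case: ((- u)%R \in A y);
    by rewrite /= ?mule0 ?mul0e ?mule1 ?mul1e ?add0e ?adde0 ?leeDl ?leeDr.
set I := \sum_x \sum_y _.
have key : (n%:R * delta)%:E <= I + (\sum_x gam (A x) + \sum_x gam (A x)).
  apply: le_trans md _.
  apply: (@le_trans _ _ (I + (\sum_x \int[gam]_u (\sum_y (m x y u * (\1_(A x) u)%:E)) +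
      \sum_x \int[gam]_u (\sum_y (m x y u * (\1_(A y) (- u)%R)%:E))))).
    rewrite /I -!big_split/=; apply: lee_sum => x _.
    rewrite -ge0_integral_sum//.
    have s1m : measurable_fun setT (fun u => \sum_y (m x y u * (\1_(A x) u)%:E)).
      by apply: emeasurable_sum => y; apply: emeasurable_funM.
    have s2m : measurable_fun setT (fun u => \sum_y (m x y u * (\1_(A y) (- u)%R)%:E)).
      by apply: emeasurable_sum => y; apply: emeasurable_funM.
    rewrite -ge0_integralD//; last 2 first.
    - by move=> u _; apply: sume_ge0 => y _; rewrite mule_ge0.
    - by move=> u _; apply: sume_ge0 => y _; rewrite mule_ge0.
    rewrite -ge0_integralD//; last 4 first.
    - by move=> u _; apply: sume_ge0 => y _.
    - by apply: emeasurable_sum => y.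
    - by move=> u _; rewrite adde_ge0//; apply: sume_ge0 => y _; rewrite mule_ge0.
    - exact: emeasurable_funD.
    apply: ge0_le_integral => //.
    - by move=> u _; exact: sume_ge0.
    - exact: emeasurable_sum.
    - apply: emeasurable_funD; first exact: emeasurable_sum.
      exact: emeasurable_funD.
    - by move=> u _; rewrite -!big_split; apply: lee_sum => y _; exact: pt.
  apply: leeD => //; apply: leeD.
    apply: lee_sum => x _.
    rewrite gaussian_indic//; apply: ge0_le_integral => //.
    - by move=> u _; apply: sume_ge0 => y _; rewrite mule_ge0.
    - by apply: emeasurable_sum => y; apply: emeasurable_funM.
    move=> u _; rewrite -ge0_sume_distrl//.
    by rewrite -[leRHS]mul1e; apply: lee_wpmul2r.
  rewrite (eq_bigr (fun x => \sum_y \int[gam]_u (m x y u * (\1_(A y) (- u)%R)%:E))); last first.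
    move=> x _; rewrite ge0_integral_sum// => y; first exact: emeasurable_funM.
    by move=> u _; rewrite mule_ge0.
  rewrite exchange_big; apply: lee_sum => y _.
  rewrite -ge0_integral_sum//; last 2 first.
  - by move=> x; exact: emeasurable_funM.
  - by move=> x u _; rewrite mule_ge0.
  rewrite gaussian_indic// -(integral_gaussianN (mAi y))//.
  apply: ge0_le_integral => //.
  - by move=> u _; apply: sume_ge0 => x _; rewrite mule_ge0.
  - by apply: emeasurable_sum => x; apply: emeasurable_funM.
  move=> u _; rewrite -ge0_sume_distrl//.
  by rewrite -[leRHS]mul1e; apply: lee_wpmul2r.
have {}key : (n%:R * delta)%:E <= I + (n%:R * (delta / 2))%:E.
  apply: le_trans key _; rewrite leeD2l//.
  apply: le_trans (leeD Abeta Abeta) _; rewrite -EFinD lee_fin.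
  by lra.
rewrite -leeBlDr// -EFinB in key; apply: le_trans key.
by rewrite lee_fin; lra.
Qed.

Lemma robust_le k (beta eta eta' : R) : (eta' <= eta)%R -> robust k beta eta ->
  robust k beta eta'.
Proof.
move=> ee H A mA Ab; apply: le_trans (H A mA Ab).
by rewrite lee_fin ler_wpM2l.
Qed.

(** Convexity of the power: [young_exp] is its tangent line at p, summed over the vertices. *)
Lemma sum_expr_ge N (t : 'I_n -> R) (p : R) : (0 <= p)%R -> (forall x, 0 <= t x)%R ->
  (n%:R * p <= \sum_x t x)%R -> (n%:R * p ^+ N.+1 <= \sum_x t x ^+ N.+1)%R.
Proof.
move=> p0 t0 pt.
have : (\sum_x (N.+1%:R * (t x * p ^+ N)) <= \sum_x (t x ^+ N.+1 + N%:R * p ^+ N.+1))%R.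
  by apply: ler_sum => x _; exact: young_exp.
rewrite -mulr_sumr -mulr_suml big_split/= sumr_const card_ord -mulr_natl.
have := ler_wpM2l (ler0n R N.+1) (ler_wpM2r (exprn_ge0 N p0) pt).
rewrite -(natr1 N) exprS; move: (p ^+ N)%R (N%:R : R) => P NN; nra.
Qed.

(** The factor (eta / 2)^2 comes from the two halves at the gluing vertex. The rest is the
    probability that correlated directions fall in [G] and in its reflection; these have equal
    measure, so the exponents b + 2 and b + 1 add up. *)
Lemma robust_step k (beta beta' eta : R) : (0 < eta)%R -> (beta' <= beta)%R ->
  robust k beta eta ->
  robust (k + k).+1 beta' ((eta / 2) ^+ 2 * (beta - beta') ^+ (b.+2 + b.+1))%R.
Proof.
move=> eta0 bb H A mA Abeta.
set a := avoid A; have na : nnfam a by exact: nnfam_avoid.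
have nJa := nnfam_reflect na.
set g := W k (J a); have ng : nnfam g by exact: nnfam_walk.
have e2 : (0 < eta / 2)%R by rewrite divr_gt0.
pose G y := [set u | (eta / 2)%:E <= g y u].
have mG y : measurable (G y).
  by rewrite -[G y]setTI; apply: emeasurable_fun_c_infty => //; exact: ng.1.
have finG y : gam (G y) \is a fin_num by exact: fin_num_measure.
have Gbig : (n%:R * (beta - beta') <= \sum_y fine (gam (G y)))%R.
  (* Otherwise A' := A u G has total measure at most n beta, although walks
     starting outside A that end outside G have mass at most n eta / 2. *)
  rewrite leNgt; apply/negP => Gsmall.
  pose A' x := A x `|` G x.
  have mA' x : measurable (A' x) by exact: measurableU.
  have A'b : \sum_x gam (A' x) <= (n%:R * beta)%:E.
    apply: (@le_trans _ _ (\sum_x gam (A x) + \sum_x gam (G x))).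
      by rewrite -big_split; apply: lee_sum => x _; exact: measureU2.
    rewrite (_ : (n%:R * beta)%R = n%:R * beta' + n%:R * (beta - beta'))%R; last by ring.
    rewrite EFinD; apply: leeD => //.
    rewrite (eq_bigr (fun x => (fine (gam (G x)))%:E)); last by move=> x _; rewrite fineK.
    by rewrite sumEFin lee_fin ltW.
  have na' : nnfam (avoid A') by exact: nnfam_avoid.
  have nG : nnfam (avoid G) by exact: nnfam_avoid.
  have := H A' mA' A'b; apply/negP; rewrite -ltNge.
  apply: (@le_lt_trans _ _ (pairing (avoid G) g)).
    apply: le_pairing => //; first exact/nnfam_walk/nnfam_reflect.
      move=> x u; rewrite /avoid lee_fin !indicE !in_setC /A' in_setU negb_or.
      by case: (_ \in A x); case: (_ \in G x).
    apply: le_walk => //; first exact: nnfam_reflect.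
    move=> x u; rewrite /reflect_fam /a /avoid lee_fin !indicE !in_setC /A' in_setU negb_or.
    by case: (_ \in A x); case: (_ \in G x).
  apply: (@le_lt_trans _ _ (\sum_(x < n) (eta / 2)%:E)).
    apply: lee_sum => x _; rewrite -(integral_prob_cst gam (eta / 2)).
    apply: ge0_le_integral => //.
    - by move=> u _; rewrite mule_ge0 ?nG.2 ?ng.2.
    - by apply: emeasurable_funM; [exact: nG.1|exact: ng.1].
    - move=> u _; rewrite /avoid indicE in_setC; case: (boolP (u \in G x)) => uG /=.
        by rewrite mul0e lee_fin ltW.
      rewrite mul1e; move: uG; rewrite notin_setE /G/= => /negP.
      by rewrite -ltNge => /ltW.
  rewrite sumEFin sumr_const card_ord -(mulr_natl (eta / 2)) lte_fin ltr_pM2l ?ltr0n//.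
  by rewrite ltr_pdivrMr// mulr_natr mulr2n ltrDl.
(* The long walk is cut at its middle T and its first half is read backwards: both halves now leave
   the same vertex, one in direction u, reflected, the other in a correlated direction. *)
rewrite walk_comp walk_adjoint//; last exact/nnfam_ou.
have nJg := nnfam_reflect ng.
rewrite -ou_reflect// ou_self_adjoint// pairing_ou//.
pose B x := -%R @^-1` G x.
have mB x : measurable (B x).
  by rewrite -[B x]setTI; exact: measurable_rVN.
have gB x : gam (B x) = gam (G x).
  rewrite gaussian_indic// [RHS]gaussian_indic// -[RHS]integral_gaussianN//.
  exact/measurable_EFinP/measurable_indic.
have mou : measurable_fun setT (fun p : 'rV[R]_d * 'rV[R]_d => w *: p.1 + s *: p.2)%R.
  exact: measurable_lincomb.
have mI (C : set 'rV[R]_d) : measurable C -> measurable_fun setT (\1_C : 'rV[R]_d -> R).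
  by move=> mC; exact: measurable_indic.
have mBG x : measurable_fun setT (fun p : 'rV[R]_d * 'rV[R]_d =>
    ((\1_(B x) p.1 : R) * \1_(G x) (w *: p.1 + s *: p.2))%R%:E).
  apply/measurable_EFinP; apply: measurable_funM.
    exact: (measurableT_comp (mI _ (mB x)) measurable_fst).
  exact: (measurableT_comp (mI _ (mG x)) mou).
have BG0 x (p : 'rV[R]_d * 'rV[R]_d) :
    0 <= ((\1_(B x) p.1 : R) * \1_(G x) (w *: p.1 + s *: p.2)%R)%R%:E.
  by rewrite lee_fin mulr_ge0.
apply: (@le_trans _ _ (\sum_x (((eta / 2) ^+ 2)%:E *
    (fine (gam (B x)) ^+ b.+2 * fine (gam (G x)) ^+ b.+1)%R%:E))).
  rewrite -ge0_sume_distrr; last first.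
    by move=> x _; rewrite lee_fin mulr_ge0// exprn_ge0// fine_ge0.
  rewrite sumEFin -EFinM lee_fin mulrCA ler_wpM2l ?sqr_ge0//.
  under eq_bigr do rewrite gB -exprD.
  rewrite addSn; apply: sum_expr_ge => //; first by rewrite subr_ge0.
  by move=> x; rewrite fine_ge0.
apply: lee_sum => x _.
have /(lee_wpmul2l (x := ((eta / 2) ^+ 2)%:E)) h := gaussian_correlated_sets s0 ws b0 wsb (mB x) (mG x).
apply: le_trans (h _) _; first by rewrite lee_fin sqr_ge0.
have mgg : measurable_fun setT (fun p : 'rV[R]_d * 'rV[R]_d =>
    J g x p.1 * g x (w *: p.1 + s *: p.2)%R).
  apply: emeasurable_funM; first exact: (measurableT_comp (nJg.1 x) measurable_fst).
  exact: (measurableT_comp (ng.1 x) mou).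
rewrite -ge0_integralZl_EFin ?sqr_ge0//; last 2 first.
- by move=> u _; apply: integral_ge0 => v _; exact: (BG0 x (u, v)).
- exact: (measurable_integral_gaussian (mBG x)).
apply: ge0_le_integral => //.
- move=> u _; rewrite mule_ge0 ?lee_fin ?sqr_ge0//.
  by apply: integral_ge0 => v _; exact: (BG0 x (u, v)).
- by apply: measurable_funeM; exact: (measurable_integral_gaussian (mBG x)).
- by apply: (measurable_integral_gaussian mgg) => p; rewrite mule_ge0 ?nJg.2 ?ng.2.
move=> u _; rewrite -ge0_integralZl_EFin ?sqr_ge0//; last first.
  exact: (measurableT_comp (mBG x) (measurable_pair1 u)).
apply: ge0_le_integral => //.
- by move=> v _; rewrite mule_ge0 ?lee_fin ?sqr_ge0//; exact: (BG0 x (u, v)).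
- by apply: measurable_funeM; exact: (measurableT_comp (mBG x) (measurable_pair1 u)).
- exact: (measurableT_comp mgg (measurable_pair1 u)).
move=> v _; rewrite !indicE.
case: (boolP (u \in B x)) => uB; last by rewrite mul0r mule0 mule_ge0 ?nJg.2 ?ng.2.
case: (boolP (_ \in G x)) => vG; last by rewrite mulr0 mule0 mule_ge0 ?nJg.2 ?ng.2.
rewrite mulr1 mule1 expr2 EFinM; apply: lee_pmul; rewrite ?lee_fin ?(ltW e2)//.
- by move: uB; rewrite inE.
- by move: vG; rewrite inE.
Qed.

(** The solution, starting from 1, of the recurrence [rateS] that collects the losses; the form
    shows the bound 12 * 2 ^ j. *)
Definition rate j := (12 * 2 ^ j - (5 * j + 11))%N.

(** Guarantees that the subtraction in [rate] is not cut off at 0. *)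
Lemma rate_small j : (5 * j + 11 <= 12 * 2 ^ j)%N.
Proof. by elim: j => // j; rewrite expnS; lia. Qed.

Lemma rateS j : rate j.+1 = (2 * rate j + 5 * j + 6)%N.
Proof. by rewrite /rate expnS; have := rate_small j; lia. Qed.

Lemma rate_step K j : (0 < K)%N ->
  (K * rate j * 2 + 1 + j.+1 * (4 * K + 1) <= K * rate j.+1)%N.
Proof.
move=> K0; rewrite rateS; move: (rate j) => N.
have : (j.+1 * (4 * K + 1) <= j.+1 * (5 * K))%N by rewrite leq_mul2l; lia.
by lia.
Qed.

(** Tolerances are halved at each level and every loss is rounded to a power of q = delta / 16: the
    tolerance drops by 2 q 2^-j at level j, which is at least q^(j+1). *)
Lemma robust_iter (delta : R) K j : (b.+1 = 2 * K)%N -> (0 < delta)%R -> (delta <= 1)%R ->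
  robust 0 (delta / 4) (delta / 2) ->
  robust (2 ^ j).-1 (delta / 4 * 2^-1 ^+ j) ((delta / 16) ^+ (K * rate j)).
Proof.
move=> bK d0 d1 H0.
have K0 : (0 < K)%N by lia.
pose q : R := (delta / 16)%R; have q0 : (0 < q)%R by rewrite divr_gt0.
have q16 : (q <= 1 / 16)%R by rewrite ler_pM2r.
have q1 : (q <= 1)%R by lra.
rewrite -/q; elim: j => [|j IH].
  rewrite expn0 expr0 mulr1 /=; apply: robust_le H0.
  have -> : (K * rate 0 = K)%N by rewrite /rate expn0; lia.
  apply: (@le_trans _ _ q); last by rewrite /q; lra.
  by rewrite -{2}(expr1 q) ler_wiXn2l// ltW.
have h : (delta / 4 * 2^-1 ^+ j.+1 <= delta / 4 * 2^-1 ^+ j)%R.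
  apply: ler_wpM2l; first by rewrite divr_ge0// ltW.
  by apply: ler_wiXn2l => //; lra.
have := robust_step (exprn_gt0 _ q0) h IH.
have -> : ((2 ^ j).-1 + (2 ^ j).-1).+1 = (2 ^ j.+1).-1.
  by rewrite expnS; have := expn_gt0 2 j; lia.
apply: robust_le.
have -> : (delta / 4 * 2^-1 ^+ j - delta / 4 * 2^-1 ^+ j.+1 = 2 * q * 2^-1 ^+ j)%R.
  by rewrite exprS /q; field.
have -> : (b.+2 + b.+1 = 4 * K + 1)%N by lia.
have p0 : (0 <= q ^+ j.+1)%R by rewrite exprn_ge0// ltW.
have phi : (q ^+ j.+1 <= 2 * q * 2^-1 ^+ j)%R.
  rewrite exprS; apply: ler_pM.
  - exact: ltW.
  - by rewrite exprn_ge0// ltW.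
  - by lra.
  - by apply: lerXn2r; rewrite ?nnegrE; lra.
(* The exponent 2 K rate j + 1 pays for the squared mass and its factor 1 / 4, and (j + 1)(4 K + 1)
   for the power of the tolerance drop. *)
apply: (@le_trans _ _ (q ^+ (K * rate j * 2 + 1) * q ^+ j.+1 ^+ (4 * K + 1))%R).
  by rewrite -exprM -exprD ler_wiXn2l ?(ltW q0)// rate_step.
have Q0 : (0 <= q ^+ (K * rate j))%R by rewrite exprn_ge0// ltW.
apply: ler_pM; first by rewrite exprn_ge0// ltW.
- by rewrite exprn_ge0.
- rewrite exprD exprM expr1; move: (q ^+ (K * rate j))%R Q0 => Q Q0.
  have -> : ((Q / 2) ^+ 2 = Q ^+ 2 * (1 / 4))%R by field.
  by apply: ler_wpM2l; [exact: sqr_ge0|lra].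
- by apply: lerXn2r; rewrite ?nnegrE// (le_trans p0).
Qed.

(** Robustness was needed only to run the induction; at the end nothing is deleted. Since K = 2^r,
    the exponent K [rate r] is at most 12 K^2. *)
Lemma walk_mass (delta : R) K r : (b.+1 = 2 * K)%N -> K = (2 ^ r)%N ->
  (0 < delta)%R -> (delta <= 1)%R ->
  (n%:R * delta)%:E <= \sum_x \int[gam]_u (\sum_y m x y u) ->
  (n%:R * (delta / 16) ^+ (12 * K ^ 2))%:E <=
    \sum_x \int[gam]_u W K.-1 (fun _ _ => 1) x u.
Proof.
move=> bK Kr d0 d1 md.
have K0 : (0 < K)%N by lia.
have H := robust_iter (j := r) bK d0 d1 (robust0 md).
have A0 : \sum_(x < n) gam set0 <= (n%:R * (delta / 4 * 2^-1 ^+ r))%:E.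
  rewrite big1; last by move=> x _; rewrite measure0.
  by rewrite lee_fin !mulr_ge0 ?exprn_ge0 ?invr_ge0// ltW.
have h := H (fun=> set0) (fun=> measurable0) A0.
apply: le_trans (le_trans h _).
  rewrite lee_fin; apply: ler_wpM2l => //; apply: ler_wiXn2l.
  - by rewrite divr_ge0// ltW.
  - by lra.
  - by rewrite /rate -Kr expnS expn1 mulnCA leq_mul2l; apply/orP; right; exact: leq_subr.
rewrite -Kr le_eqVlt; apply/orP; left; apply/eqP.
have aE : avoid (fun=> set0) = (fun _ _ => 1).
  by apply/funext => x; apply/funext => u; rewrite /avoid setC0 indicT.
rewrite /pairing aE; apply: eq_bigr => x _; apply: eq_integral => u _.
by rewrite mul1e.
Qed.

End robust.

(** * From covers to walks *)

Section matchings.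
Variable n : nat.
Implicit Types (M : gmatching n) (p q : vpath n).

Lemma measurable_gmatching d (Z : measurableType d) (f : gmatching n -> Z) :
  measurable_fun setT f.
Proof. by []. Qed.

Definition starts (x : 'I_n) M : bool := has (fun p => pfirst p == x) (enum_fset (gmpaths M)).

Lemma startsP x M : reflect (exists2 p, p \in gmpaths M & pfirst p = x) (starts x M).
Proof.
by apply: (iffP hasP) => -[p pM /eqP px]; exists p => //; apply/eqP.
Qed.

Lemma card_gmatching M : #|` gmpaths M| = (\sum_(x < n) starts x M)%N.
Proof.
have /asboolP[_ inj1 _] := gmatchingP M.
transitivity (\sum_(p <- gmpaths M) \sum_(x < n) (pfirst p == x))%N.
  rewrite (eq_bigr (fun=> 1%N)); first by rewrite sum1_size.
  move=> p _; rewrite (bigD1 (pfirst p))//= eqxx big1// => x.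
  by rewrite eq_sym => /negbTE->.
rewrite exchange_big/=; apply: eq_bigr => x _.
case: startsP => [[p pM <-]|nx].
  rewrite (big_fsetD1 p)//= eqxx big1_fset// => q.
  rewrite !inE => /andP[qp qM] _; apply/eqP; rewrite eqb0; apply: contra qp => /eqP.
  by move=> /inj1 ->.
rewrite big1_fset// => p pM _; apply/eqP; rewrite eqb0; apply/eqP => px.
by apply: nx; exists p.
Qed.

Definition edge (x y : 'I_n) M : bool := (x, [:: y]) \in gmpaths M.

Lemma edge_inj x y y' M : edge x y M -> edge x y' M -> y = y'.
Proof.
have /asboolP[_ inj1 _] := gmatchingP M.
by move=> e1 e2; have [] := inj1 _ _ e1 e2 erefl.
Qed.

Lemma sum_edge_le x M : (\sum_y edge x y M <= starts x M)%N.
Proof.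
have [y xy|no] := pickP (edge x ^~ M).
  rewrite (bigD1 y)//= xy big1 => [|z zy].
    by rewrite (_ : starts x M)//; apply/startsP; exists (x, [:: y]).
  by apply/eqP; rewrite eqb0; apply: contra zy => xz; rewrite (edge_inj xy xz).
by rewrite big1// => y _; rewrite no.
Qed.

(** At most one term is nonzero: x has a single edge, and it extends by the path of [M'] starting at
    its end. *)
Lemma sum_edge_starts x M M' :
  (\sum_y edge x y M * starts y M' <= starts x (gcomp M M'))%N.
Proof.
have [y /andP[xy yM']|no] := pickP (fun y => edge x y M && starts y M').
  rewrite (bigD1 y)//= xy yM' big1 => [|z zy].
    rewrite (_ : starts x (gcomp M M'))//; apply/startsP.
    case/startsP: yM' => q qM' qy; exists (pcat (x, [:: y]) q) => //.
    apply/imfset2P; exists (x, [:: y]) => //=; exists q => //.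
    by rewrite !inE/= qM' /plast /= qy eqxx.
  by apply/eqP; rewrite muln_eq0 eqb0; apply/orP; left; apply: contra zy => xz; rewrite (edge_inj xy xz).
rewrite big1// => y _; have := no y.
by case: (edge x y M); case: (starts y M').
Qed.

Lemma edge_grev x y M : edge y x (grev M) = edge x y M.
Proof.
apply/imfsetP/idP => [[[a t] /= pM]|xy]; last by exists (x, [:: y]).
rewrite /preverse/=; case: t pM => [|c t] pM /=; first by case.
case=> ey; case: t ey pM => [|e t] /= ey pM; last first.
  by move=> /(congr1 size); rewrite size_rev /=.
by rewrite /rev/= => -[->]; rewrite /edge ey.
Qed.

Lemma card_one_hop M : (forall p, p \in gmpaths M -> size p.2 = 1%N) ->
  #|` gmpaths M| = (\sum_x \sum_y edge x y M)%N.
Proof.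
move=> hop; rewrite card_gmatching; apply: eq_bigr => x _; apply/eqP.
rewrite eqn_leq sum_edge_le andbT; case: startsP => // -[[a t] pM /= ax].
have := hop _ pM; case: t pM => [//|y [|//]] pM _.
rewrite /pfirst/= in ax; rewrite ax in pM.
by rewrite (bigD1 y)//= /edge pM.
Qed.

End matchings.

Section chain.
Local Open Scope ereal_scope.
Variables (R : realType) (d n : nat).
Implicit Types (C : matching_cover R d n) (M : gmatching n).
Notation gam := (gaussian R d).

(** Matchings are countable, so those of probability 0 form a null set; properties on the support
    become almost sure ones. *)
Lemma support_ae C u (P : gmatching n -> Prop) :
  (forall M, in_support C u M -> P M) -> {ae C u, forall M, P M}.
Proof.
move=> sP; exists [set M | C u [set M] = 0]; split => //.
  pose F k := if (choice.unpickle k : option (gmatching n)) is Some M then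
     (if `[< C u [set M] = 0 >] then [set M] else set0) else set0.
  apply/eqP; rewrite eq_le measure_ge0 andbT.
  apply: (@le_trans _ _ (\sum_(k <oo) C u (F k))).
    apply: measure_sigma_subadditive => // M /= M0.
    by exists (choice.pickle M) => //; rewrite /F choice.pickleK asboolT.
  rewrite eseries0// => k _ _; rewrite /F.
  by case: choice.unpickle => [M|]; rewrite ?measure0//; case: asboolP => [->|_]; rewrite ?measure0.
move=> M /= PM; apply: contrapT => M0; apply: PM; apply: sP; rewrite /in_support lt0e.
by rewrite measure_ge0 andbT; apply/eqP.
Qed.

Lemma measurable_integral_cover C (F : 'rV[R]_d -> gmatching n -> \bar R) :
  (forall M, measurable_fun setT (F ^~ M)) -> (forall u M, 0 <= F u M) ->
  measurable_fun setT (fun u => \int[C u]_M F u M).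
Proof.
move=> mF F0.
apply: (measurable_fun_integral_finite_kernel (fun p => F p.1 p.2) C).
  by move=> p; exact: F0.
exact: measurable_fun_countable_snd.
Qed.

Lemma integral_cover_cst C u (r : R) : \int[C u]_M r%:E = r%:E.
Proof. by rewrite integral_cst// prob_kernel mule1. Qed.

Lemma integral_chainS om k C u (F : gmatching n -> \bar R) : (forall M, 0 <= F M) ->
  \int[chain om k.+1 C u]_M F M =
  \int[C u]_M \int[gam]_g
     \int[chain om k C (om *: u + Num.sqrt (1 - om ^+ 2) *: g)%R]_M' F (gcomp M M').
Proof.
move=> F0; apply: etrans (integral_kcomp _ _ _ F0 (measurable_gmatching _)) _.
apply: eq_integral => M _.
apply: etrans (integral_kcomp _ _ _ F0 (measurable_gmatching _)) _.
pose G (y : 'rV[R]_d) := \int[chain om k C y]_M' F (gcomp M M').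
have mG : measurable_fun setT G by exact: (measurable_integral_cover _ (fun=> measurable_cst _)).
have G0 y : 0 <= G y by exact: integral_ge0.
transitivity (\int[correlated d om u]_y G y).
  apply: eq_integral => y _.
  apply: etrans (integral_kcomp _ _ _ F0 (measurable_gmatching _)) _.
  by apply: eq_integral => M' _ /=; rewrite integral_dirac// diracT mul1e.
apply: etrans (integral_kcomp _ _ _ G0 mG) _.
by apply: eq_integral => g _ /=; rewrite integral_dirac// diracT mul1e.
Qed.

Definition edge_prob C (x y : 'I_n) (u : 'rV[R]_d) : \bar R := C u [set M | edge x y M].

Lemma edge_probE C x y u : edge_prob C x y u = \int[C u]_M ((edge x y M)%:R : R)%:E.
Proof.
rewrite /edge_prob -[X in C u X]setIT -integral_indic//.
apply: eq_integral => M _; rewrite indicE; congr ((nat_of_bool _)%:R%:E).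
by apply/idP/idP; rewrite inE.
Qed.

Lemma measurable_edge_prob C x y : measurable_fun setT (edge_prob C x y).
Proof. exact: (measurable_kernel C). Qed.

Lemma edge_prob_le1 C x u : \sum_y edge_prob C x y u <= 1.
Proof.
under eq_bigr do rewrite edge_probE.
rewrite -ge0_integral_sum//.
rewrite -(integral_cover_cst C u 1).
apply: ge0_le_integral => //.
  by move=> M _; apply: sume_ge0.
move=> M _; rewrite sumEFin lee_fin -natr_sum lern1.
by rewrite (leq_trans (sum_edge_le x M))// leq_b1.
Qed.

(** Supplies the hypothesis [mN] of the walk operators. *)
Lemma edge_probN C x y u : skew_symmetric C -> edge_prob C x y (- u)%R = edge_prob C y x u.
Proof.
move=> skC; rewrite /edge_prob -(skC u [set M | edge y x M]) /pushforward.
congr (C _ _); apply/seteqP; split => M /=; rewrite edge_grev//.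
Qed.

Definition start_prob om k C (x : 'I_n) u : \bar R :=
  \int[chain om k C u]_M ((starts x M)%:R : R)%:E.

Lemma nnfam_start_prob om k C : nnfam (start_prob om k C).
Proof.
split => [x|x u]; last by apply: integral_ge0 => M _; rewrite lee_fin.
by apply: measurable_integral_cover => [M|u M]; rewrite ?lee_fin//; exact: measurable_cst.
Qed.

(** Conditioning on the first matching: it is independent of the later choices, so edge
    probabilities multiply with later start probabilities, and [sum_edge_starts] compares the two
    sides sample by sample. Paths that are not single edges only help the right side. *)
Lemma walk_start_prob om k C x u :
  walk_fam om (Num.sqrt (1 - om ^+ 2)) (edge_prob C) k (fun _ _ => 1) x u
    <= start_prob om k C x u.
Proof.
elim: k x u => [|k IH] x u.
  rewrite /= /step_fam /start_prob /=.
  under eq_bigr do rewrite mule1 edge_probE.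
  rewrite -ge0_integral_sum//; apply: ge0_le_integral => //.
    by move=> M _; apply: sume_ge0.
  by move=> M _; rewrite sumEFin lee_fin -natr_sum ler_nat sum_edge_le.
have n1 : nnfam (fun (_ : 'I_n) (_ : 'rV[R]_d) => 1 : \bar R).
  by split => // z; exact: measurable_cst.
have nW := nnfam_walk om (Num.sqrt (1 - om ^+ 2)) (measurable_edge_prob C)
  (fun x y u => measure_ge0 _ _) k n1.
have nD := nnfam_start_prob om k C.
set s := Num.sqrt (1 - om ^+ 2) in nW *.
apply: (@le_trans _ _ (step_fam (edge_prob C) (ou_fam om s (start_prob om k C)) x u)).
  apply: le_step => [y z v|y z]; first exact: measure_ge0.
  exact: le_ou.
have nT := nnfam_ou om s nD.
rewrite /start_prob integral_chainS; last by move=> M; rewrite lee_fin.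
rewrite /step_fam.
rewrite (eq_bigr (fun y => \int[C u]_M ((edge x y M)%:R%:E * ou_fam om s (start_prob om k C) y u))); last first.
  move=> y _; rewrite edge_probE ge0_integralZr//; exact: nT.2.
rewrite -ge0_integral_sum//; last by move=> y M _; rewrite mule_ge0 ?lee_fin ?nT.2.
apply: ge0_le_integral => //.
- by move=> M _; apply: sume_ge0 => y _; rewrite mule_ge0 ?lee_fin ?nT.2.
move=> M _.
have mG (F : gmatching n -> \bar R) : (forall M', 0 <= F M') ->
    measurable_fun setT (fun g : 'rV[R]_d => \int[chain om k C (om *: u + s *: g)%R]_M' F M').
  move=> F0.
  have := @measurable_integral_cover (chain om k C) (fun=> F) (fun=> measurable_cst _) (fun=> F0).
  move=> mI; apply: (measurableT_comp mI).
  apply: measurable_rVP => i; under eq_fun do rewrite !mxE.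
  by apply: measurable_funD => //; apply: measurable_funM => //; exact: measurable_coord.
rewrite /ou_fam (eq_bigr (fun y => \int[gam]_g \int[chain om k C (om *: u + s *: g)%R]_M'
   (((edge x y M)%:R : R)%:E * ((starts y M')%:R : R)%:E))); last first.
  move=> y _; rewrite -ge0_integralZl_EFin//.
  - by apply: eq_integral => g _; rewrite -ge0_integralZl_EFin.
  - by move=> g _; exact: nD.2.
  - by apply: mG => M'; rewrite lee_fin.
rewrite -ge0_integral_sum//; last 2 first.
- by move=> y; apply: mG => M'; rewrite mule_ge0.
- by move=> y g _; apply: integral_ge0 => M' _; rewrite mule_ge0.
apply: ge0_le_integral => //.
- by move=> g _; apply: sume_ge0 => y _; apply: integral_ge0 => M' _; rewrite mule_ge0.
- by apply: emeasurable_sum => y; apply: mG => M'; rewrite mule_ge0.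
- by apply: mG => M'; rewrite lee_fin.
move=> g _; rewrite -ge0_integral_sum//.
apply: ge0_le_integral => //.
- by move=> M' _; apply: sume_ge0 => y _; rewrite mule_ge0.
move=> M' _; under eq_bigr do rewrite -EFinM -natrM.
by rewrite sumEFin lee_fin -natr_sum ler_nat sum_edge_starts.
Qed.

Lemma measurable_integral_card C : measurable_fun setT
  (fun u => \int[C u]_M ((#|` gmpaths M|)%:R : R)%:E).
Proof. by apply: measurable_integral_cover => [M|u M]; [exact: measurable_cst|rewrite lee_fin]. Qed.

Lemma cover_sizeE C : (0 < n)%N ->
  n%:R%:E * cover_size C = \int[gam]_u \int[C u]_M ((#|` gmpaths M|)%:R : R)%:E.
Proof.
move=> n0; rewrite /cover_size muleA -EFinM divff ?mul1e//.
by rewrite pnatr_eq0 -lt0n.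
Qed.

Lemma cover_size_edge V Delta C : (0 < n)%N -> khop V Delta 1 C ->
  n%:R%:E * cover_size C = \sum_x \int[gam]_u (\sum_y edge_prob C x y u).
Proof.
move=> n0 hopC; rewrite cover_sizeE// -ge0_integral_sum//; last 2 first.
- by move=> x; apply: emeasurable_sum => y; exact: measurable_edge_prob.
- by move=> x u _; apply: sume_ge0 => y _; exact: measure_ge0.
apply: eq_integral => u _.
transitivity (\int[C u]_M ((\sum_x \sum_y edge x y M)%:R : R)%:E).
  apply: ae_eq_integral => //.
  have H : {ae C u, forall M, #|` gmpaths M| = (\sum_x \sum_y edge x y M)%N}.
    by apply: support_ae => M sM; apply: card_one_hop => p pM; have [] := hopC u M p sM pM.
  by apply: filterS H => M eM _; rewrite eM.
under eq_bigr do under eq_bigr do rewrite edge_probE.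
under [RHS]eq_bigr do rewrite -ge0_integral_sum//.
rewrite -ge0_integral_sum//; last by move=> x M _; apply: sume_ge0.
apply: eq_integral => M _; rewrite natr_sum -sumEFin; apply: eq_bigr => x _.
by rewrite natr_sum -sumEFin.
Qed.

Lemma chain_size_ge om k C : (0 < n)%N ->
  \sum_x \int[gam]_u
      walk_fam om (Num.sqrt (1 - om ^+ 2)) (edge_prob C) k (fun _ _ => 1) x u
    <= n%:R%:E * cover_size (chain om k C).
Proof.
move=> n0; rewrite cover_sizeE//.
have n1 : nnfam (fun (_ : 'I_n) (_ : 'rV[R]_d) => 1 : \bar R).
  by split => // z; exact: measurable_cst.
have nW := nnfam_walk om (Num.sqrt (1 - om ^+ 2)) (measurable_edge_prob C)
  (fun x y u => measure_ge0 _ _) k n1.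
rewrite -ge0_integral_sum//; [|exact: nW.1|by move=> x u _; exact: nW.2].
apply: ge0_le_integral => //.
- by move=> u _; apply: sume_ge0 => x _; exact: nW.2.
- by apply: emeasurable_sum => x; exact: nW.1.
- exact: measurable_integral_card.
move=> u _; apply: (@le_trans _ _ (\sum_x start_prob om k C x u)).
  by apply: lee_sum => x _; exact: walk_start_prob.
rewrite /start_prob -ge0_integral_sum//.
apply: ge0_le_integral => //.
  by move=> M _; apply: sume_ge0.
by move=> M _; rewrite sumEFin lee_fin -natr_sum card_gmatching.
Qed.

End chain.

(** * Stretch of the paths *)

Section dot.
Variables (R : realType) (d : nat).
Implicit Types x y u g : 'rV[R]_d.

Lemma dotDl x y u : dot (x + y) u = dot x u + dot y u.
Proof. by rewrite /dot -big_split; apply: eq_bigr => i _; rewrite mxE mulrDl. Qed.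

Lemma dotZl (a : R) x u : dot (a *: x) u = a * dot x u.
Proof. by rewrite /dot mulr_sumr; apply: eq_bigr => i _; rewrite mxE mulrA. Qed.

Lemma dotC x y : dot x y = dot y x.
Proof. by rewrite /dot; apply: eq_bigr => i _; rewrite mulrC. Qed.

Lemma dot_lincomb x (a c : R) u g : dot x (a *: u + c *: g) = a * dot x u + c * dot x g.
Proof. by rewrite dotC dotDl !dotZl (dotC u) (dotC g). Qed.

Lemma sqnormZ (a : R) x : sqnorm (a *: x) = a ^+ 2 * sqnorm x.
Proof. by rewrite /sqnorm dotZl dotC dotZl expr2 mulrA. Qed.

End dot.

Section paths.
Variables (R : realType) (d n : nat) (V : 'I_n -> 'rV[R]_d) (Delta : R).
Implicit Types (p q : vpath n) (M : gmatching n) (u : 'rV[R]_d) (l : R).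

Lemma pdisp_pcat p q : plast p = pfirst q -> pdisp V (pcat p q) = pdisp V p + pdisp V q.
Proof.
move=> pq; rewrite /pdisp plast_pcat// -pq (_ : pfirst (pcat p q) = pfirst p)//.
by rewrite [RHS]addrC subrKA.
Qed.

Lemma pcost_pcat p q : plast p = pfirst q -> pcost V (pcat p q) = pcost V p + pcost V q.
Proof.
case: p q => [x t] [y t']; rewrite /plast /pfirst/= => <-.
by rewrite /pcost/= pairmap_cat big_cat.
Qed.

Lemma infix_violating p q : infix (pverts p) (pverts q) ->
  violating V Delta p -> violating V Delta q.
Proof.
by move=> pq /asboolP[p' [p'p p'0 cp']]; apply/asboolP; exists p'; split => //; exact: infix_trans pq.
Qed.

Lemma nonviolating_pcat p q : plast p = pfirst q -> ~~ violating V Delta (pcat p q) ->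
  ~~ violating V Delta p /\ ~~ violating V Delta q.
Proof.
move=> pq nv; split; apply: contra nv; apply: infix_violating; apply/infixP.
  by exists [::], q.2.
exists (belast p.1 p.2), [::]; rewrite cats0 -[LHS]/((p.1 :: p.2) ++ q.2).
by rewrite lastI cat_rcons; move: pq; rewrite /plast => ->.
Qed.

(** The whole path is one of the contiguous subsequences tested. *)
Lemma nonviolating_sqnorm p : p.2 != [::] -> ~~ violating V Delta p ->
  sqnorm (pdisp V p) <= pcost V p + Delta.
Proof.
move=> p0 nv; rewrite leNgt; apply: contra nv => h; apply/asboolP; exists p.
by split => //; [exact: infix_refl|rewrite lerBrDr ltW].
Qed.

(** The Chernoff functional for paths of small stretch. Violating paths are left out because
    truncation keeps them. *)
Definition weight l u M : R :=
  \sum_(p <- gmpaths M | ~~ violating V Delta p) expR (- (l * dot (pdisp V p) u)).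

Lemma weight_ge0 l u M : 0 <= weight l u M.
Proof. by apply: sumr_ge0 => p _; exact: expR_ge0. Qed.

Lemma card_gmatching_le M : (#|` gmpaths M| <= n)%N.
Proof.
rewrite card_gmatching (@leq_trans (\sum_(x < n) 1))//.
  by apply: leq_sum => x _; exact: leq_b1.
by rewrite sum1_card card_ord.
Qed.

Lemma weight_le_card (sigma l : R) u M : 0 <= l ->
  (forall p, p \in gmpaths M -> ~~ violating V Delta p -> sigma <= dot (pdisp V p) u) ->
  weight l u M <= n%:R * expR (- (l * sigma)).
Proof.
move=> l0 su; apply: (@le_trans _ _ (\sum_(p <- gmpaths M) expR (- (l * sigma)))).
  rewrite /weight big_mkcond/= !big_seq; apply: ler_sum => p pM.
  case: ifPn => nv; last exact: expR_ge0.
  by rewrite ler_expR lerN2 ler_wpM2l// su.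
rewrite big_const_seq count_predT iter_addr addr0 -(mulr_natl (expR _)) ler_wpM2r ?expR_ge0//.
by rewrite ler_nat card_gmatching_le.
Qed.

Lemma sum_plast M (P : pred (vpath n)) (f : vpath n -> R) p :
  p \in gmpaths M -> P p ->
  \sum_(q <- gmpaths M | P q && (plast q == plast p)) f q = f p.
Proof.
have /asboolP[_ _ inj] := gmatchingP M.
move=> pM Pp; rewrite big_mkcond (big_fsetD1 p)//= Pp eqxx/= big1_fset ?addr0// => q.
rewrite !inE => /andP[qp qM] _; case: ifP => // /andP[_ /eqP h].
by rewrite (inj _ _ qM pM h) eqxx in qp.
Qed.

(** Paths are sorted by last vertex. A composite shares its last vertex with its second part, and
    last vertices are distinct on both sides, so each composite is charged to its own path of [M'];
    the first part contributes the factor. *)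
Lemma weight_gcomp (sigma l : R) u M M' : 0 <= l ->
  (forall p, p \in gmpaths M -> ~~ violating V Delta p -> sigma <= dot (pdisp V p) u) ->
  weight l u (gcomp M M') <= expR (- (l * sigma)) * weight l u M'.
Proof.
move=> l0 su; rewrite /weight mulr_sumr.
rewrite (partition_big (@plast n) xpredT)//= [leRHS](partition_big (@plast n) xpredT)//=.
apply: ler_sum => z _.
have [/hasP[r rG /andP[nvr /eqP rz]]|] := boolP (has (fun r => ~~ violating V Delta r && (plast r == z))
    (enum_fset (gmpaths (gcomp M M')))); last first.
  rewrite -all_predC => /allP h; rewrite big1_fset; last by move=> r /h/negP.
  by apply: sumr_ge0 => q _; rewrite mulr_ge0// expR_ge0.
pose f p := expR (- (l * dot (pdisp V p) u)).
have := sum_plast (P := fun p => ~~ violating V Delta p) f rG nvr.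
rewrite rz /= => ->.
case/imfset2P: rG rz nvr => p /= pM [q]; rewrite !inE/= => /andP[qM' /eqP pq] -> rz nvr.
have [nvp nvq] := nonviolating_pcat pq nvr.
rewrite -rz plast_pcat// (sum_plast (P := fun p => ~~ violating V Delta p) (fun q => _ * f q) qM')//.
rewrite /f -expRD ler_expR pdisp_pcat// dotDl mulrDr opprD lerD2r lerN2.
by rewrite ler_wpM2l// su.
Qed.

Lemma measurable_weight l M : measurable_fun setT (weight l ^~ M).
Proof.
rewrite /weight; under eq_fun do rewrite -big_filter.
apply: measurable_sum => p; apply: measurableT_comp => //.
by apply: measurableT_comp => //; apply: measurable_funM => //; exact: dot_measurable.
Qed.

(** The part of the direction along u scales l by om; the independent noise costs one Gaussian
    exponential moment per path. *)
Lemma integral_weight_ou l (om s B : R) u M : 0 <= s ->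
  (forall p, p \in gmpaths M -> ~~ violating V Delta p -> sqnorm (pdisp V p) <= B) ->
  (\int[gaussian R d]_g (weight l (om *: u + s *: g)%R M)%:E <=
   (expR (l ^+ 2 * s ^+ 2 * B / 2) * weight (l * om) u M)%:E)%E.
Proof.
move=> s0 pB; rewrite /weight.
under eq_integral do rewrite -sumEFin -big_filter.
have mE (p : vpath n) : measurable_fun setT (fun g : 'rV[R]_d =>
    (expR (- (l * dot (pdisp V p) (om *: u + s *: g))))%:E).
  apply/measurable_EFinP; apply: measurableT_comp => //; apply: measurableT_comp => //.
  apply: measurable_funM => //; apply: (measurableT_comp (dot_measurable (pdisp V p))).
  exact: measurable_lincomb.
rewrite ge0_integral_sum//.
rewrite mulr_sumr -sumEFin -[leRHS]big_filter.
rewrite big_seq [leRHS]big_seq; apply: lee_sum => p.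
rewrite mem_filter => /andP[nv pM].
rewrite (eq_integral (fun g => ((expR (- (l * om * dot (pdisp V p) u)))%:E *
    (expR (dot ((- (l * s)) *: pdisp V p) g))%:E)%E)); last first.
  move=> g _; rewrite -EFinM -expRD dot_lincomb dotZl; congr (expR _)%:E; ring.
rewrite ge0_integralZl_EFin ?expR_ge0//; last first.
  by apply/measurable_EFinP; apply: measurableT_comp => //; exact: dot_measurable.
rewrite gaussian_mgf -EFinM lee_fin mulrC ler_wpM2r ?expR_ge0// ler_expR.
rewrite sqnormZ sqrrN exprMn; apply: ler_wpM2r; first by rewrite invr_ge0.
by apply: ler_wpM2l; [rewrite mulr_ge0 ?sqr_ge0|exact: pB].
Qed.

(** Markov's inequality: a path removed by truncation has stretch below t, hence contributes at
    least 1 to the last term. *)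
Lemma card_truncate_weight (t l : R) u M : 0 <= l ->
  (#|` gmpaths M|)%:R <=
    (#|` gmpaths (truncate V Delta t (u, M))|)%:R + expR (l * t) * weight l u M :> R.
Proof.
move=> l0; rewrite !card_fset_sum1 !natr_sum /truncate/=.
rewrite -big_fset_condE/= /weight mulr_sumr [X in _ <= X + _]big_mkcond/= [X in _ <= _ + X]big_mkcond/= -big_split/=.
apply: ler_sum => p _; case: (violating V Delta p) => /=; first by rewrite addr0.
case: (leP t (dot (pdisp V p) u)) => [_|tp].
  by rewrite lerDl mulr_ge0// expR_ge0.
by rewrite add0r -expRD -expR0 ler_expR -mulrBr mulr_ge0// subr_ge0 ltW.
Qed.

End paths.

Section cover_at.
Variables (R : realType) (d n : nat) (C : matching_cover R d n) (u : 'rV[R]_d).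

(** Names the measure so that it can carry a probability structure, used when Fubini-Tonelli is
    applied to it. *)
Definition cover_at : set (gmatching n) -> \bar R := C u.
HB.instance Definition _ := Measure.on cover_at.

Let cover_atT : cover_at [set: gmatching n] = 1%E.
Proof. by rewrite /cover_at prob_kernel. Qed.

HB.instance Definition _ := @Measure_isProbability.Build _ _ R cover_at cover_atT.

End cover_at.

(** * Exponential moments of the stretch along the chain *)

Section bad_paths.
Local Open Scope ereal_scope.
Variables (R : realType) (d n : nat) (V : 'I_n -> 'rV[R]_d) (Delta sigma om : R).
Variable C : matching_cover R d n.
Hypotheses (Delta0 : (0 < Delta)%R) (om0 : (0 <= om)%R) (om1 : (om < 1)%R).
Hypotheses (hopC : khop V Delta 1 C) (strC : stretched V Delta sigma C).
Notation gam := (gaussian R d).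
Let s := Num.sqrt (1 - om ^+ 2).

Let s2 : (s ^+ 2 = 1 - om ^+ 2)%R.
Proof. by rewrite sqr_sqrtr// subr_ge0 expr_le1// ltW. Qed.

Let s0 : (0 < s)%R.
Proof. by rewrite sqrtr_gt0 subr_gt0 expr_lt1. Qed.

Let cheap k := [set M : gmatching n | forall p, p \in gmpaths M ->
  (pcost V p <= k.+1%:R * Delta)%R].

Lemma integral_indic_gmatching (mu : {measure set (gmatching n) -> \bar R}) A :
  \int[mu]_M ((\1_A M : R)%:E) = mu A.
Proof. by rewrite integral_indic// setIT. Qed.

(** Each of the k + 1 hops costs at most [Delta]. The hop bound holds only on supports, so the
    induction carries null sets through the iterated integrals. *)
Lemma chain_cheap k u : {ae chain om k C u, forall M, cheap k M}.
Proof.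
suff h : chain om k C u (~` cheap k) = 0.
  by apply/negligibleP => //; exact: h.
have cheapC v M : in_support C v M -> cheap 0 M.
  move=> sM [x t] pM; have [] := hopC sM pM; case: t pM => [//|y [|//]] pM _ /=.
  by rewrite andbT /pcost/= big_seq1 mul1r.
elim: k u => [|k IH] u.
  have /negligibleP := support_ae (cheapC u); apply => //.
have h (v : 'rV[R]_d) (A : set (gmatching n)) : chain om k C v A = 0 ->
    forall F : gmatching n -> \bar R, (forall M', 0 <= F M') -> (forall M', ~ A M' -> F M' = 0) ->
    \int[chain om k C v]_M' F M' = 0.
  move=> A0 F F0 FA; rewrite (@ae_eq_integral _ _ _ _ _ (cst 0) _ measurableT)//.
    by rewrite integral0.
  by exists A; split => // M' /=; apply: contra_notP => nA _; exact: FA.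
transitivity (\int[chain om k.+1 C u]_M ((\1_(~` cheap k.+1) M : R)%:E)).
  exact: esym (integral_indic_gmatching _ _).
rewrite integral_chainS; last by move=> M; rewrite lee_fin.
rewrite (@ae_eq_integral _ _ _ _ _ (cst 0) _ measurableT)//; first by rewrite integral0.
apply: filterS (support_ae (cheapC u)) => M cM _ /=.
rewrite (eq_integral (cst 0)); first by rewrite integral0.
move=> g _; apply: h (IH _) _ _ _ => [M'|M']; first by rewrite lee_fin.
move=> /contrapT cM'; rewrite indicE memNset// => /= -[] r.
case/imfset2P => p /= pM [q]; rewrite !inE/= => /andP[qM' /eqP pq] ->.
rewrite pcost_pcat// -(natr1 k.+1) mulrDl addrC; apply: lerD; first exact: cM'.
exact: cM.
Qed.

Definition potential k (l : R) : \bar R :=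
  \int[gam]_u \int[chain om k C u]_M (weight V Delta l u M)%:E.

Lemma measurable_weight_chain k l :
  measurable_fun setT (fun u => \int[chain om k C u]_M (weight V Delta l u M)%:E).
Proof.
apply: measurable_integral_cover => [M|u M]; last by rewrite lee_fin weight_ge0.
by apply/measurable_EFinP; exact: measurable_weight.
Qed.

Lemma potential0 (l : R) : (0 <= l)%R ->
  potential 0 l <= (n%:R * expR (- (l * sigma)))%:E.
Proof.
move=> l0; rewrite -(integral_prob_cst gam).
apply: ge0_le_integral => //.
- by move=> u _; apply: integral_ge0 => M _; rewrite lee_fin weight_ge0.
- exact: measurable_weight_chain.
move=> u _; rewrite /= -(integral_cover_cst C u).
apply: ae_ge0_le_integral => //.
- by move=> M _; rewrite lee_fin weight_ge0.
have H : {ae C u, forall M, forall p, p \in gmpaths M -> ~~ violating V Delta p ->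
    (sigma <= dot (pdisp V p) u)%R}.
  by apply: support_ae => M sM p; exact: strC.
by apply: filterS H => M HM _; rewrite lee_fin; exact: weight_le_card.
Qed.

(** The first hop gains [sigma] in direction u. The remainder, sampled from a correlated direction,
    is still weighed in u; averaging u given that direction replaces l by l om. The quadratic term
    uses the squared displacement of a nonviolating path of k + 1 hops, at most (k + 1) Delta +
    Delta. *)
Lemma potentialS k (l : R) : (0 <= l)%R ->
  potential k.+1 l <=
    (expR (- (l * sigma) + l ^+ 2 * s ^+ 2 * (k.+2%:R * Delta) / 2))%:E * potential k (l * om).
Proof.
move=> l0; have lom0 : (0 <= l * om)%R by rewrite mulr_ge0.
(* The first component is the direction in which paths are weighed, the second the one from which
   they are sampled. *)
pose h (p : 'rV[R]_d * 'rV[R]_d) := \int[chain om k C p.2]_M' (weight V Delta l p.1 M')%:E.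
have mh : measurable_fun setT h.
  apply: (measurable_fun_integral_finite_kernel (fun p => (weight V Delta l p.1.1 p.2)%:E)
    (kprecomp (chain om k C) measurable_snd)).
    by move=> p; rewrite lee_fin weight_ge0.
  apply: measurable_fun_countable_snd => M /=; apply/measurable_EFinP.
  by apply: (measurableT_comp (measurable_weight V Delta l M)); exact: measurable_fst.
have h0 p : 0 <= h p by apply: integral_ge0 => M _; rewrite lee_fin weight_ge0.
have mou : measurable_fun setT (fun p : 'rV[R]_d * 'rV[R]_d => om *: p.1 + s *: p.2)%R.
  exact: measurable_lincomb.
have mh1 := measurableT_comp mh (measurable_fun_pair measurable_fst mou).
have mh2 := measurableT_comp mh (measurable_fun_pair mou measurable_fst).
apply: (@le_trans _ _ (\int[gam]_u ((expR (- (l * sigma)))%:E *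
    \int[gam]_g h (u, om *: u + s *: g)%R))).
  apply: ge0_le_integral => //.
  - by move=> u _; apply: integral_ge0 => M _; rewrite lee_fin weight_ge0.
  - exact: measurable_weight_chain.
  - by apply: measurable_funeM; apply: (measurable_integral_gaussian mh1) => p; exact: h0.
  move=> u _; rewrite integral_chainS; last by move=> M; rewrite lee_fin weight_ge0.
  set Y := (X in _ <= X).
  have Y0 : 0 <= Y by rewrite mule_ge0// ?lee_fin ?expR_ge0//; apply: integral_ge0.
  have -> : Y = \int[C u]_M cst Y M by rewrite integral_cst// prob_kernel mule1.
  apply: ae_ge0_le_integral => //.
  - move=> M _; apply: integral_ge0 => g _; apply: integral_ge0 => M' _.
    by rewrite lee_fin weight_ge0.
  have H : {ae C u, forall M, forall p, p \in gmpaths M -> ~~ violating V Delta p ->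
      (sigma <= dot (pdisp V p) u)%R}.
    by apply: support_ae => M sM p; exact: strC.
  apply: filterS H => M HM _ /=.
  rewrite /Y -ge0_integralZl_EFin ?expR_ge0//; last first.
    exact: (measurableT_comp mh1 (measurable_pair1 u)).
  apply: ge0_le_integral => //.
  - move=> g _; apply: integral_ge0 => M' _.
    by rewrite lee_fin weight_ge0.
  - apply: (@measurableT_comp _ _ _ _ _ _
      (fun v => \int[chain om k C v]_M' (weight V Delta l u (gcomp M M'))%:E)).
      apply: measurable_integral_cover => [M'|v M']; first exact: measurable_cst.
      by rewrite lee_fin weight_ge0.
    exact: (measurableT_comp mou (measurable_pair1 u)).
  - by apply: measurable_funeM; exact: (measurableT_comp mh1 (measurable_pair1 u)).
  move=> g _; rewrite /h/= -ge0_integralZl_EFin ?expR_ge0//; last first.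
    by move=> M' _; rewrite lee_fin weight_ge0.
  apply: ge0_le_integral => //.
  - by move=> M' _; rewrite lee_fin weight_ge0.
  - by move=> M' _; rewrite -EFinM lee_fin; exact: weight_gcomp.
rewrite ge0_integralZl_EFin ?expR_ge0//; last 2 first.
- by move=> u _; apply: integral_ge0.
- by apply: (measurable_integral_gaussian mh1) => p; exact: h0.
rewrite expRD EFinM -muleA lee_wpmul2l ?lee_fin ?expR_ge0//.
(* Reversibility makes the first direction a noisy copy of the second one, with
   noise independent of the rest of the path. *)
have -> : \int[gam]_u \int[gam]_g h (u, om *: u + s *: g)%R =
    \int[gam]_u \int[gam]_g h (om *: u + s *: g, u)%R.
  by apply: (ou_exchange (w := om) (s := s)) => //; rewrite s2 addrC subrK.
rewrite /potential -ge0_integralZl_EFin ?expR_ge0//; last 2 first.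
- by move=> u _; apply: integral_ge0 => M _; rewrite lee_fin weight_ge0.
- exact: measurable_weight_chain.
apply: ge0_le_integral => //.
- by move=> u _; apply: integral_ge0 => g _; exact: h0.
- by apply: (measurable_integral_gaussian mh2) => p; exact: h0.
- by apply: measurable_funeM; exact: measurable_weight_chain.
move=> u _.
have -> : \int[gam]_g h (om *: u + s *: g, u)%R =
    \int[cover_at (chain om k C) u]_M' \int[gam]_g (weight V Delta l (om *: u + s *: g)%R M')%:E.
  apply: (fubini_tonelli (m1 := gam) (m2 := cover_at (chain om k C) u)
    (fun q => (weight V Delta l (om *: u + s *: q.1)%R q.2)%:E)).
    apply: measurable_fun_countable_snd => M /=; apply/measurable_EFinP.
    apply: (measurableT_comp (measurable_weight V Delta l M)).
    exact: (measurableT_comp mou (measurable_pair1 u)).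
  by move=> q; rewrite lee_fin weight_ge0.
rewrite -ge0_integralZl_EFin ?expR_ge0//; last first.
  by move=> M' _; rewrite lee_fin weight_ge0.
apply: ae_ge0_le_integral => //.
- by move=> M' _; apply: integral_ge0 => g _; rewrite lee_fin weight_ge0.
- by move=> M' _; rewrite mule_ge0// lee_fin ?weight_ge0 ?expR_ge0.
apply: filterS (chain_cheap k u) => M' cM' _.
rewrite -EFinM; apply: integral_weight_ou; first exact: ltW.
move=> p pM' nv; have /asboolP[ne _ _] := gmatchingP M'.
apply: le_trans (nonviolating_sqnorm (ne p pM') nv) _.
by rewrite -(natr1 k.+1) mulrDl mul1r lerD2r cM'.
Qed.

(** Unrolling [potentialS] with l, l om, l om^2, ... gives the geometric sum of gains. Each
    quadratic cost is at most Delta l^2, since (k + 2) s^2 <= K s^2 <= 2. *)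
Lemma potential_le K k (l : R) : (K%:R * s ^+ 2 <= 2)%R -> (k < K)%N -> (0 <= l)%R ->
  potential k l <= (n%:R * expR (- (l * sigma * \sum_(i < k.+1) om ^+ i) + k%:R * Delta * l ^+ 2))%:E.
Proof.
move=> Ks; elim: k l => [|k IH] l kK l0.
  by apply: le_trans (potential0 l0) _; rewrite big_ord1 expr0 mulr1 !mul0r addr0.
apply: le_trans (potentialS k l0) _.
have lom0 : (0 <= l * om)%R by rewrite mulr_ge0.
apply: le_trans (lee_wpmul2l _ (IH _ (ltnW kK) lom0)) _; first by rewrite lee_fin expR_ge0.
rewrite -EFinM lee_fin mulrCA -expRD ler_wpM2l// ler_expR.
rewrite [X in (_ <= - (_ * X) + _)%R]big_ord_recl expr0.
under [X in (_ <= - (_ * (_ + X)) + _)%R]eq_bigr do rewrite /= exprS.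
rewrite -mulr_sumr; set S := (\sum_(i < k.+1) _)%R.
have h1 : (l ^+ 2 * s ^+ 2 * (k.+2%:R * Delta) / 2 <= Delta * l ^+ 2)%R.
  have -> : (l ^+ 2 * s ^+ 2 * (k.+2%:R * Delta) / 2 =
      Delta * l ^+ 2 * (k.+2%:R * s ^+ 2 / 2))%R by field.
  rewrite -[leRHS]mulr1 ler_wpM2l//; first by rewrite mulr_ge0 ?sqr_ge0// ltW.
  rewrite ler_pdivrMr// mul1r; apply: le_trans Ks.
  by rewrite ler_wpM2r ?sqr_ge0// ler_nat.
have h2 : (k%:R * Delta * (l * om) ^+ 2 <= k%:R * Delta * l ^+ 2)%R.
  rewrite ler_wpM2l//; first by rewrite mulr_ge0// ltW.
  by rewrite exprMn -[leRHS]mulr1 ler_wpM2l ?sqr_ge0// expr_le1// ltW.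
rewrite -(natr1 k).
have -> : (l * sigma * (1 + om * S) = l * sigma + l * om * sigma * S)%R by ring.
by move: h1 h2; lra.
Qed.

End bad_paths.

(** * Truncation and the choice of constants *)

Section truncated.
Local Open Scope ereal_scope.
Variables (R : realType) (d n : nat) (V : 'I_n -> 'rV[R]_d) (Delta : R).
Implicit Types C : matching_cover R d n.
Notation gam := (gaussian R d).

Lemma measurable_card_truncate t (M : gmatching n) : measurable_fun setT
  (fun u => ((#|` gmpaths (truncate V Delta t (u, M))|)%:R : R)%:E).
Proof.
have mt := measurableT_comp (truncate_measurable V Delta t) (measurable_pair2 M).
exact: (measurableT_comp (measurable_gmatching
  (fun N : gmatching n => ((#|` gmpaths N|)%:R : R)%:E)) mt).
Qed.

Lemma cover_size_truncated t C : (0 < n)%N ->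
  n%:R%:E * cover_size (truncated V Delta t C) =
  \int[gam]_u \int[C u]_M ((#|` gmpaths (truncate V Delta t (u, M))|)%:R : R)%:E.
Proof.
move=> n0; rewrite cover_sizeE//; apply: eq_integral => u _.
apply: etrans (integral_kcomp _ _ _ _ (measurable_gmatching _)) _.
  by move=> M; rewrite lee_fin.
by apply: eq_integral => M _; rewrite /= integral_dirac// diracT mul1e.
Qed.

Lemma cover_size_split t l om k C : (0 < n)%N -> (0 <= l)%R ->
  n%:R%:E * cover_size (chain om k C) <=
  n%:R%:E * cover_size (truncated V Delta t (chain om k C)) +
    (expR (l * t))%:E * potential V Delta om C k l.
Proof.
move=> n0 l0; rewrite cover_sizeE// cover_size_truncated// /potential.
have mw := measurable_weight_chain V Delta om C k l.
have mt : measurable_fun setT (fun u => \int[chain om k C u]_M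
    ((#|` gmpaths (truncate V Delta t (u, M))|)%:R : R)%:E).
  apply: measurable_integral_cover => [M|u M]; last by rewrite lee_fin.
  exact: measurable_card_truncate.
have w0 u : 0 <= \int[chain om k C u]_M (weight V Delta l u M)%:E.
  by apply: integral_ge0 => M _; rewrite lee_fin weight_ge0.
rewrite -ge0_integralZl_EFin ?expR_ge0// -ge0_integralD//; last 3 first.
- by move=> u _; apply: integral_ge0 => M _; rewrite lee_fin.
- by move=> u _; rewrite mule_ge0// lee_fin expR_ge0.
- exact: measurable_funeM.
apply: ge0_le_integral => //.
- by move=> u _; apply: integral_ge0 => M _; rewrite lee_fin.
- exact: measurable_integral_card.
- by apply: emeasurable_funD => //; exact: measurable_funeM.
move=> u _; rewrite -ge0_integralZl_EFin ?expR_ge0//; last first.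
  by move=> M _; rewrite lee_fin weight_ge0.
rewrite -ge0_integralD//; last first.
  by move=> M _; rewrite mule_ge0// lee_fin ?expR_ge0 ?weight_ge0.
apply: ge0_le_integral => //.
by move=> M _; rewrite -EFinM -EFinD lee_fin; exact: card_truncate_weight.
Qed.

End truncated.

(** With om = 1 - 1/K the first direction stays correlated with all K of them: om^K <= 1/e <= 1/2,
    so the stretch accumulates linearly in K. *)
Lemma sum_geometric_ge (R : realType) (K : nat) : (0 < K)%N ->
  (K%:R / 2 <= \sum_(i < K) (1 - K%:R^-1) ^+ i :> R).
Proof.
move=> K0; set om : R := 1 - K%:R^-1.
have KR : 0 < K%:R :> R by rewrite ltr0n.
have K1 : K%:R^-1 <= 1 :> R by rewrite invf_le1// ler1n.
have omK : om ^+ K <= 2^-1.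
  apply: (@le_trans _ _ (expR (- K%:R^-1) ^+ K)).
    by apply: lerXn2r; rewrite ?nnegrE ?expR_ge0 ?subr_ge0//; exact: expR_ge1Dx.
  rewrite -expRM_natl mulrN divff ?gt_eqF// expRN lef_pV2 ?posrE ?expR_gt0//.
  by have := expR_ge1Dx (1 : R); lra.
have -> : \sum_(i < K) om ^+ i = K%:R * (1 - om ^+ K).
  rewrite -opprB subrX1 (_ : om - 1 = - K%:R^-1); last by rewrite /om; ring.
  by rewrite mulNr opprK mulrA divff ?mul1r// gt_eqF.
by apply: ler_wpM2l; [exact: ltW|move: omK; lra].
Qed.

Theorem theorem4 (R : realType) (delta sigma : R) :
  0 < delta -> 0 < sigma ->
  exists c1 c2 c3 : R, [/\ 0 < c1, 0 < c2, 0 < c3 &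
    forall (d n : nat) (V : 'I_n -> 'rV[R]_d) (Delta : R)
           (Matching : matching_cover R d n) (K r : nat),
      (1 <= d)%N -> (1 <= n)%N -> injective V -> 0 < Delta ->
      khop V Delta 1 Matching ->
      stretched V Delta sigma Matching ->
      skew_symmetric Matching ->
      (delta%:E <= cover_size Matching)%E ->
      K%:R * Delta <= c1 ->
      K = (2 ^ r)%N ->
      ((expR (- (c3 * K%:R ^+ 2)))%:E <=
        cover_size (truncated V Delta (c2 * K%:R) (sample_paths K Matching)))%E].
Proof.
move=> delta0 sigma0.
(* [walk_mass] asks for a density of at most 1. *)
pose delta' := Num.min delta 1.
have d'0 : 0 < delta' by rewrite lt_min delta0 ltr01.
have d'1 : delta' <= 1 by rewrite ge_min lexx orbT.
pose q := delta' / 16.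
have q0 : 0 < q by rewrite divr_gt0.
have q16 : q <= 1 / 16 by rewrite ler_pM2r.
pose L := - ln q.
have L0 : 0 < L by rewrite oppr_gt0 ln_lt0// q0; lra.
have qE : q = expR (- L) by rewrite opprK lnK.
(* Chosen so that the optimal Chernoff exponent, - sigma^2 K^2 / (64 c1), equals - 24 L K^2, twice
   the exponent of the lower bound q^(12 K^2) for all paths. *)
pose c1 := sigma ^+ 2 / (64 * (24 * L)).
have c10 : 0 < c1 by rewrite divr_gt0 ?exprn_gt0 ?mulr_gt0.
exists c1, (sigma / 4), (24 * L); split => //.
- by rewrite divr_gt0.
- by rewrite mulr_gt0.
move=> d n V Delta C K r _ n0 _ Delta0 hopC strC skC sizeC KD Kr.
have K0 : (0 < K)%N by rewrite Kr expn_gt0.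
have KR : 0 < K%:R :> R by rewrite ltr0n.
have K1 : K%:R^-1 <= 1 :> R by rewrite invf_le1// ler1n.
have Ki0 : 0 < K%:R^-1 :> R by rewrite invr_gt0.
set om : R := 1 - K%:R^-1.
have om0 : 0 <= om by rewrite subr_ge0.
have om1 : om < 1 by rewrite ltrBlDr ltrDl.
pose s := Num.sqrt (1 - om ^+ 2).
have s2 : s ^+ 2 = 1 - om ^+ 2 by rewrite sqr_sqrtr// subr_ge0 expr_le1// ltW.
have s0 : 0 < s by rewrite sqrtr_gt0 subr_gt0 expr_lt1.
have Ks2 : K%:R * s ^+ 2 = 1 + om.
  by rewrite s2 /om; field; rewrite gt_eqF.
(* The choice b = 2 K - 1 turns s^2 b into (1 + om)^2, which is at least 2 om^2. *)
have bK : (2 * K).-1.+1 = (2 * K)%N by rewrite prednK// muln_gt0.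
have wsb : 2 * om ^+ 2 <= s ^+ 2 * (2 * K).-1%:R.
  have -> : (2 * K).-1%:R = 2 * K%:R - 1 :> R.
    by apply: (addIr 1); rewrite natr1 bK natrM subrK.
  have -> : s ^+ 2 * (2 * K%:R - 1) = (1 + om) ^+ 2.
    by rewrite mulrBr mulrCA (mulrC (s ^+ 2)) Ks2 s2; ring.
  by nra.
have b0 : (0 < (2 * K).-1)%N by rewrite -ltnS bK leq_pmulr.
have KsL : K%:R * s ^+ 2 <= 2 by rewrite Ks2; lra.
have mass : ((n%:R * delta')%:E <= \sum_x \int[gaussian R d]_u (\sum_y edge_prob C x y u))%E.
  rewrite -(cover_size_edge n0 hopC) EFinM lee_pmul2l ?lte_fin ?ltr0n//.
  by apply: le_trans sizeC; rewrite lee_fin ge_min lexx.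
have W := walk_mass n0 (measurable_edge_prob C) (fun x y u => measure_ge0 _ _)
  (fun x y u => edge_probN x y u skC) (edge_prob_le1 C)
  s0 (etrans (congr1 _ s2) (subrKC _ _)) b0 wsb bK Kr d'0 d'1 mass.
have {}W := le_trans W (chain_size_ge om K.-1 C n0).
pose t := sigma / 4 * K%:R.
(* The minimizer of - l sigma K / 4 + c1 l^2: the gain is at least l sigma K / 2, and the target
   stretch t uses up half of it. *)
pose l := sigma * K%:R / (8 * c1).
have l0 : 0 <= l by apply/ltW/divr_gt0; apply: mulr_gt0.
have {}W := le_trans W (cover_size_split V Delta t om K.-1 C n0 l0).
have kK : (K.-1 < K)%N by rewrite ltn_predL.
have pot := potential_le Delta0 om0 om1 hopC strC KsL kK l0.
set S := \sum_(i < _) om ^+ i in pot.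
have exponent : l * t + (- (l * sigma * S) + K.-1%:R * Delta * l ^+ 2) <= - (24 * L * K%:R ^+ 2).
  have hS : l * sigma * (K%:R / 2) <= l * sigma * S.
    apply: ler_wpM2l; first by rewrite mulr_ge0// ltW.
    by have := sum_geometric_ge R K0; rewrite /S prednK.
  have hD : K.-1%:R * Delta * l ^+ 2 <= c1 * l ^+ 2.
    apply: ler_wpM2r; first exact: sqr_ge0.
    by apply: le_trans KD; rewrite ler_pM2r// ler_nat leq_pred.
  have e : l * t - l * sigma * (K%:R / 2) + c1 * l ^+ 2 = - (24 * L * K%:R ^+ 2).
    by rewrite /l /t /c1; field; rewrite (gt_eqF L0) (gt_eqF sigma0).
  by move: hS hD; rewrite -e; lra.
have powq N : q ^+ (N * K ^ 2) = expR (- (N%:R * L * K%:R ^+ 2)).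
  by rewrite qE -expRM_natl natrM natrX; congr expR; ring.
have {}W : ((n%:R * q ^+ (12 * K ^ 2))%:E <=
    n%:R%:E * cover_size (truncated V Delta t (sample_paths K C)) +
    (n%:R * q ^+ (24 * K ^ 2))%:E)%E.
  apply: le_trans W _; rewrite leeD2l//.
  apply: le_trans (lee_wpmul2l _ pot) _; first by rewrite lee_fin expR_ge0.
  rewrite -EFinM lee_fin mulrCA -expRD ler_wpM2l// powq ler_expR.
  exact: exponent.
rewrite -leeBlDr// -EFinB in W.
rewrite -(@lee_pmul2l _ n%:R%:E) ?lte_fin ?ltr0n//.
apply: (le_trans _ W); rewrite -EFinM lee_fin -mulrBr ler_wpM2l// -powq.
(* With y = q^(12 K^2), at least y - y^2 paths per vertex survive, and this is at least y^2 because
   y <= 1 / 16; hence c3 = 24 L. *)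
have -> : q ^+ (24 * K ^ 2) = (q ^+ (12 * K ^ 2)) ^+ 2 by rewrite -exprM mulnAC.
have y0 : 0 < q ^+ (12 * K ^ 2) by rewrite exprn_gt0.
have y1 : q ^+ (12 * K ^ 2) <= 1 / 16.
  apply: (le_trans _ q16); rewrite -[leRHS]expr1; apply: ler_wiXn2l; first exact: ltW.
    by apply: (le_trans q16); lra.
  by rewrite muln_gt0 expn_gt0 K0.
by move: (q ^+ (12 * K ^ 2)) y0 y1 => y y0 y1; nra.
Qed.
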